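(* Fix $\sigma>0$. Consider a sequence of problems indexed by $(k,n,p)$ with $p\to\infty$, $k/p\to0$ and $p=O(n)$, with random designs $X\in\mathbb{R}^{n\times p}$ having i.i.d. $\mathcal{N}(0,1/n)$ entries. Then for any $\epsilon>0$, $$\inf_{\hat\beta}\ \sup_{\|\beta\|_0\le k}\mathbb{P}\left(\frac{\|X\hat\beta-X\beta\|^2}{2\sigma^2k\log(p/k)}>1-\epsilon\right)\longrightarrow1,$$ where the infimum is over all estimators $\hat\beta$ (measurable functions of $(X,y)$).
   Context: $k,n,p$ are positive integers. We observe $(X,y)$ with $y=X\beta+z$, where $\beta\in\mathbb{R}^p$ is unknown and $z\sim\mathcal{N}(0,\sigma^2I_n)$ is independent of $X$. $\|\beta\|_0$ is the number of nonzero entries of $\beta$ and $\|\cdot\|$ is the Euclidean norm. The supremum is over all $\beta\in\mathbb{R}^p$ with at most $k$ nonzero entries. *)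

(* Defs.v *)
From HB Require Import structures.
From mathcomp Require Import all_boot all_order all_algebra.
From mathcomp Require Import all_classical all_reals all_analysis.

Set Implicit Arguments.
Unset Strict Implicit.
Unset Printing Implicit Defensive.

Import Order.TTheory GRing.Theory Num.Theory.
Import numFieldNormedType.Exports.

Local Open Scope classical_set_scope.
Local Open Scope ring_scope.

(* Matrices carry the product sigma-algebra, i.e. the one generated by the
   entries; for real matrices this is the Borel sigma-algebra of R^(m x n). *)
Definition mx_sigma d (T : sigmaRingType d) (m n : nat) :
    set (set 'M[T]_(m, n)) :=
  <<s \bigcup_(ij in [set: 'I_m * 'I_n])
        preimage_set_system [set: 'M[T]_(m, n)]
          (fun A : 'M[T]_(m, n) => A ij.1 ij.2) measurable >>.

Definition measure_mx_display : measure_display -> measure_display.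
Proof. exact. Qed.

Section measurable_matrix.
Context {d} {T : sigmaRingType d} {m n : nat}.

Let mx_set0 : mx_sigma (T := T) (m := m) (n := n) set0.
Proof. exact: sigma_algebra0. Qed.

Let mx_setC (A : set 'M[T]_(m, n)) : mx_sigma A -> mx_sigma (~` A).
Proof. exact: sigma_algebraC. Qed.

Let mx_bigcup (F : (set 'M[T]_(m, n))^nat) :
  (forall i, mx_sigma (F i)) -> mx_sigma (\bigcup_i (F i)).
Proof. exact: sigma_algebra_bigcup. Qed.

HB.instance Definition _ := @isMeasurable.Build (measure_mx_display d)
  'M[T]_(m, n) (@mx_sigma d T m n) mx_set0 mx_setC mx_bigcup.

End measurable_matrix.

Section norms.
Context {R : realType} {n : nat}.

Definition l0norm (v : 'cV[R]_n) : nat := #|[set i | v i 0 != 0]%SET|.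

(* The norm `|v| that the library puts on matrices is the max norm. *)
Definition l2norm (v : 'cV[R]_n) : R := Num.sqrt (\sum_(i < n) v i 0 ^+ 2).

End norms.

Section independence.
Context d (T : measurableType d) (R : realType) (P : probability T R).

Definition mutually_independent (I : finType) d' (T' : measurableType d')
    (X : I -> T -> T') : Prop :=
  forall (J : {set I}) (A : I -> set T'), (forall i, measurable (A i)) ->
    P (\bigcap_(i in [set` J]) X i @^-1` A i) =
    (\prod_(i in J) P (X i @^-1` A i))%E.

Definition independent_rv d1 d2 (T1 : measurableType d1)
    (T2 : measurableType d2) (X : T -> T1) (Y : T -> T2) : Prop :=
  forall (A : set T1) (B : set T2), measurable A -> measurable B ->
    P (X @^-1` A `&` Y @^-1` B) = (P (X @^-1` A) * P (Y @^-1` B))%E.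

(* The parameter s of normal_prob is the standard deviation. *)
Definition has_normal_law (mu s : R) (X : T -> R) : Prop :=
  forall A : set R, measurable A -> P (X @^-1` A) = normal_prob mu s A.

(* For X an n-vector, this says X ~ N(mu 1_n, s^2 I_n). *)
Definition iid_normal_entries (mu s : R) (m n : nat)
    (X : {RV P >-> 'M[R]_(m, n)}) : Prop :=
  mutually_independent
    (fun (ij : 'I_m * 'I_n) (w : T) => X w ij.1 ij.2) /\
  (forall i j, has_normal_law mu s (fun w => X w i j)).

End independence.

Definition estimator (R : realType) (n p : nat) : Type :=
  {mfun ('M[R]_(n, p) * 'cV[R]_n)%type >-> 'cV[R]_p}.

Section linear_model.
Context d (T : measurableType d) (R : realType) (P : probability T R).
Context (n p : nat) (X : {RV P >-> 'M[R]_(n, p)}) (z : {RV P >-> 'cV[R]_n}).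

Definition response (beta : 'cV[R]_p) (w : T) : 'cV[R]_n :=
  X w *m beta + z w.

Definition prediction_loss (bhat : estimator R n p) (beta : 'cV[R]_p)
    (w : T) : R :=
  l2norm (X w *m bhat (X w, response beta w) - X w *m beta) ^+ 2.

Definition minimax_prob (sigma : R) (k : nat) (eps : R) : \bar R :=
  ereal_inf [set
    ereal_sup [set
      P [set w | prediction_loss bhat beta w /
                   (2 * sigma ^+ 2 * k%:R * ln (p%:R / k%:R)) > 1 - eps]
    | beta in [set b : 'cV[R]_p | (l0norm b <= k)%N]]
  | bhat in [set: estimator R n p]].

End linear_model.

(* Main.v *)
Require Import Defs.
From HB Require Import structures.
From mathcomp Require Import all_boot all_order all_algebra.
From mathcomp Require Import all_classical all_reals all_analysis.
From mathcomp Require Import measurable_realfun ring lra.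

Set Implicit Arguments.
Unset Strict Implicit.
Unset Printing Implicit Defensive.

Import Order.TTheory GRing.Theory Num.Theory.
Import numFieldNormedType.Exports.

Local Open Scope classical_set_scope.
Local Open Scope ring_scope.

(** The lower bound comes from a prior on sparse signals.  Split the columns into
    k disjoint blocks of q = p/k columns, choose one column J b uniformly in every
    block b, and let beta_J be mu times the indicator of the chosen columns,
    with mu^2 slightly below 2 sigma^2 ln q.  If the estimator succeeds with
    probability bounded below for every k-sparse signal, it does so on average
    over J; it is shown that it cannot.

    Fix the design and let v be the estimated mean X bhat.  Success means that
    X beta_J lies in the ball of squared radius
    r = (1 - eps) 2 sigma^2 k ln (p/k), centred at v, and r is smaller than
    (1 - eps') k mu^2.  When X almost preserves the norms of the differences
    beta_J - beta_J', two signals that agree on few blocks have images at squared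
    distance about 2 k mu^2, and a ball of squared radius below k mu^2 contains
    only boundedly many points with such separations (ball_packing).  A maximal
    separated family inside the ball is therefore a list of at most M candidates,
    M depending on eps only, and every J for which the estimator succeeds agrees
    with one of the candidates on a positive fraction of the blocks
    (packing_cover).  So success would identify J b, up to M guesses, in a
    positive fraction of the blocks b.

    That is impossible one block at a time, even if all other blocks are
    revealed: moving the mean of y by mu times a column X_j multiplies the
    density by a likelihood ratio which, outside an event of negligible
    probability, is at most e^tau with tau < ln q, because
    |mu X_j|^2 / (2 sigma^2) < ln q (shift_probability_le).  Guessing one index
    among q with M guesses then succeeds with probability at most
    M e^tau / q + o(1), which tends to 0 (fixed_design_bound).

    The design is good for all the vectors that matter: there are at most
    q^(2k) + kq of them, each fails with probability exp (- c n)
    (sqnorm_mulmx_tail), and k ln (p/k) = o(p) = o(n), which is where k/p -> 0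
    and p = O(n) enter.

    All facts about Gaussian vectors are derived from a single principle, lemma
    resample: an entry of a matrix with independent entries may be integrated out
    separately.  Integrating out the entries one after the other gives both the
    Cameron-Martin formula for shifts (gaussian_shift) and the Laplace transform
    of |X u|^2 (gaussian_laplace). *)

(** * Measurability of matrix-valued maps *)

Section measurable_matrix_theory.
Context {d} {T : measurableType d} {R : realType} {m n : nat}.

Lemma measurable_entry (i : 'I_m) (j : 'I_n) :
  measurable_fun [set: 'M[R]_(m, n)] (fun A : 'M[R]_(m, n) => A i j).
Proof.
move=> _ B mB; apply: sub_sigma_algebra.
by exists (i, j) => //; exists B.
Qed.

Lemma measurable_fun_mx (f : T -> 'M[R]_(m, n)) :
  (forall i j, measurable_fun setT (fun t => f t i j)) -> measurable_fun setT f.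
Proof.
move=> mf; apply: (@measurability _ _ _ _ _ _ (\bigcup_(ij in [set: 'I_m * 'I_n])
        preimage_set_system [set: 'M[R]_(m, n)]
          (fun A : 'M[R]_(m, n) => A ij.1 ij.2) measurable)) => //.
move=> _ [_ [[i j] _ [B mB <-]] <-].
by have := mf i j measurableT B mB; rewrite !setTI.
Qed.

Lemma measurable_fun_entry (f : T -> 'M[R]_(m, n)) i j :
  measurable_fun setT f -> measurable_fun setT (fun t => f t i j).
Proof. by move=> mf; apply: (measurableT_comp (measurable_entry i j)). Qed.

End measurable_matrix_theory.

Section measurable_matrix_operations.
Context {d} {T : measurableType d} {R : realType} {m n p : nat}.

Lemma measurable_fun_mulmx (f : T -> 'M[R]_(m, n)) (g : T -> 'M[R]_(n, p)) :
  measurable_fun setT f -> measurable_fun setT g ->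
  measurable_fun setT (fun t => f t *m g t).
Proof.
move=> mf mg; apply: measurable_fun_mx => i j.
under eq_fun do rewrite mxE.
by apply: measurable_sum => l; apply: measurable_funM; exact: measurable_fun_entry.
Qed.

Lemma measurable_fun_addmx (f g : T -> 'M[R]_(m, n)) :
  measurable_fun setT f -> measurable_fun setT g ->
  measurable_fun setT (fun t => f t + g t).
Proof.
move=> mf mg; apply: measurable_fun_mx => i j.
under eq_fun do rewrite mxE.
by apply: measurable_funD; exact: measurable_fun_entry.
Qed.

Lemma measurable_fun_submx (f g : T -> 'M[R]_(m, n)) :
  measurable_fun setT f -> measurable_fun setT g ->
  measurable_fun setT (fun t => f t - g t).
Proof.
move=> mf mg; apply: measurable_fun_mx => i j.
under eq_fun do rewrite !mxE.
by apply: measurable_funB; exact: measurable_fun_entry.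
Qed.

End measurable_matrix_operations.

Section squared_norm.
Context {R : realType} {n : nat}.

Definition sqnorm (v : 'cV[R]_n) : R := \sum_(i < n) v i 0 ^+ 2.

Lemma sqnorm_ge0 v : 0 <= sqnorm v.
Proof. by apply: sumr_ge0 => i _; exact: sqr_ge0. Qed.

Lemma sqnormZ (a : R) v : sqnorm (a *: v) = a ^+ 2 * sqnorm v.
Proof. by rewrite /sqnorm mulr_sumr; apply: eq_bigr => i _; rewrite mxE exprMn. Qed.

Lemma sqnorm_delta (i : 'I_n) : sqnorm (delta_mx i 0) = 1.
Proof.
rewrite /sqnorm (bigD1 i)//= mxE !eqxx expr1n big1 ?addr0// => j /negbTE ji.
by rewrite mxE ji expr0n.
Qed.

Lemma l2norm_sqr (v : 'cV[R]_n) : l2norm v ^+ 2 = sqnorm v.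
Proof. by rewrite /l2norm sqr_sqrtr ?sqnorm_ge0. Qed.

Lemma measurable_fun_sqnorm d (T : measurableType d) (f : T -> 'cV[R]_n) :
  measurable_fun setT f -> measurable_fun setT (fun t => sqnorm (f t)).
Proof.
move=> mf; apply: measurable_sum => i.
by apply: measurable_funX; exact: measurable_fun_entry.
Qed.

End squared_norm.

Lemma measurable_le_set d (T : measurableType d) (R : realType) (f g : T -> R) :
  measurable_fun setT f -> measurable_fun setT g -> measurable [set t | f t <= g t].
Proof. by move=> mf mg; rewrite -[X in measurable X]setTI; exact: measurable_fun_le. Qed.

Lemma measurable_sum_cond d (T : measurableType d) (R : realType) (I : finType) (Q : pred I)
    (h : I -> T -> R) : (forall i, Q i -> measurable_fun setT (h i)) ->
  measurable_fun setT (fun x => \sum_(i | Q i) h i x).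
Proof.
move=> mh; rewrite (_ : (fun x => _) = fun x => \sum_i (if Q i then h i x else 0)).
  by apply: measurable_sum => i; case: (boolP (Q i)) => // Qi; exact: mh.
by apply/funext => x; exact: big_mkcond.
Qed.

Section finite_partition.
Context d (T : measurableType d) (I : finType) (D : T -> {set I}).

Lemma measurable_preimage_finset (Q : pred {set I}) :
  (forall i, measurable [set y | i \in D y]) -> measurable [set y | Q (D y)].
Proof.
move=> mD; rewrite (_ : [set y | Q (D y)] =
  \bigcup_(A in [set A | Q A]) \bigcap_(i in [set: I])
    (if i \in A then [set y | i \in D y] else ~` [set y | i \in D y])).
  apply: fin_bigcup_measurable => // A _; apply: fin_bigcap_measurable => // i _.
  by case: ifP => _; [exact: mD|exact/measurableC/mD].
apply/seteqP; split => [y Qy|y [A QA AD]].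
  by exists (D y) => // i _; case: ifPn => //= /negP.
rewrite /= (_ : D y = A)//; apply/finset.setP => i; have := AD i Logic.I.
by case: ifPn => //= _ /negP/negbTE.
Qed.

End finite_partition.

(** * Independence and resampling of one entry *)

Section independence_fubini.
Context d (T : measurableType d) (R : realType) (P : probability T R).
Context d1 d2 (T1 : measurableType d1) (T2 : measurableType d2).
Local Open Scope ereal_scope.

(** The joint law of independent variables is the product of their laws, since
    both agree on rectangles; Tonelli does the rest. *)
Lemma independent_integral (U : T -> T1) (V : T -> T2) (f : T1 * T2 -> \bar R) :
  measurable_fun setT U -> measurable_fun setT V -> independent_rv P U V ->
  measurable_fun setT f -> (forall x, 0 <= f x) ->
  \int[P]_w f (U w, V w) = \int[P]_w \int[P]_w' f (U w, V w').
Proof.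
move=> mU mV indep mf f0.
pose U' : {mfun T >-> T1} := HB.pack U (isMeasurableFun.Build _ _ _ _ _ mU).
pose V' : {mfun T >-> T2} := HB.pack V (isMeasurableFun.Build _ _ _ _ _ mV).
have mUV : measurable_fun setT (fun w => (U w, V w)) by exact: measurable_fun_pair.
pose UV : {mfun T >-> (T1 * T2)%type} :=
  HB.pack (fun w => (U w, V w)) (isMeasurableFun.Build _ _ _ _ _ mUV).
transitivity (\int[distribution P UV]_x f x).
  by rewrite ge0_integral_distribution.
transitivity (\int[distribution P U' \x distribution P V']_x f x).
  apply: eq_measure_integral => A mA _; apply/esym.
  exact: product_measure_unique.
rewrite fubini_tonelli1//.
rewrite ge0_integral_distribution//; last 2 first.
- exact: measurable_fun_fubini_tonelli_F.
- by move=> x; apply: integral_ge0.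
apply: eq_integral => w _ /=.
rewrite /fubini_F ge0_integral_distribution//.
exact: measurableT_comp.
Qed.

End independence_fubini.

Section setmx.
Context {R : realType} {m n : nat}.

Definition setmx (A : 'M[R]_(m, n)) (ij : 'I_m * 'I_n) (t : R) : 'M[R]_(m, n) :=
  \matrix_(a, b) if (a, b) == ij then t else A a b.

Lemma setmx_id A ij : setmx A ij (A ij.1 ij.2) = A.
Proof. by apply/matrixP => a b; rewrite mxE; case: eqP => // <-. Qed.

Lemma setmx_setmx A ij s t : setmx (setmx A ij s) ij t = setmx A ij t.
Proof. by apply/matrixP => a b; rewrite !mxE; case: eqP. Qed.

Lemma measurable_fun_setmx d (T : measurableType d) (f : T -> 'M[R]_(m, n)) ij (g : T -> R) :
  measurable_fun setT f -> measurable_fun setT g ->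
  measurable_fun setT (fun t => setmx (f t) ij (g t)).
Proof.
move=> mf mg; apply: measurable_fun_mx => i j.
under eq_fun do rewrite mxE.
by case: eqP => // _; exact: measurable_fun_entry.
Qed.

Definition rectangle (F : 'I_m * 'I_n -> set R) : set 'M[R]_(m, n) :=
  [set A | forall ij, F ij (A ij.1 ij.2)].

Lemma measurable_rectangle F : (forall ij, measurable (F ij)) -> measurable (rectangle F).
Proof.
move=> mF; rewrite (_ : rectangle F = \bigcap_(ij in [set: 'I_m * 'I_n])
    ((fun A : 'M[R]_(m, n) => A ij.1 ij.2) @^-1` F ij)).
  apply: fin_bigcap_measurable => // ij _.
  by have := measurable_entry (ij.1) (ij.2) measurableT (mF ij); rewrite setTI.
by apply/seteqP; split => [A AF ij _|A AF ij]; exact: AF.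
Qed.

(** With the stability of rectangles under intersection, this makes a finite
    measure on matrices determined by its values on rectangles. *)
Lemma measurable_mx_rectangle : @measurable _ 'M[R]_(m, n) =
  <<s [set rectangle F | F in [set F | forall ij, measurable (F ij)]] >>.
Proof.
apply/seteqP; split; last first.
  apply: smallest_sub; first exact: sigma_algebra_measurable.
  by move=> _ [F mF <-]; exact: measurable_rectangle.
apply: smallest_sub; first exact: smallest_sigma_algebra.
move=> _ [ij _ [B mB <-]]; apply: sub_sigma_algebra.
exists (fun kl => if kl == ij then B else setT).
  by move=> kl; case: eqP.
apply/seteqP; split => [A /(_ ij)|A [_ BA] kl]; first by rewrite eqxx.
by case: eqP => // ->.
Qed.

End setmx.

Section iid_matrix.
Context d (T : measurableType d) (R : realType) (P : probability T R) (m n : nat).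
Context (Y : {RV P >-> 'M[R]_(m, n)}) (mu s : R).
Hypothesis iidY : iid_normal_entries mu s Y.
Local Open Scope ereal_scope.

Let mY i j : measurable_fun setT (fun w => Y w i j).
Proof. exact: measurable_fun_entry. Qed.

Lemma rectangle_independent (F : 'I_m * 'I_n -> set R) : (forall ij, measurable (F ij)) ->
  P (Y @^-1` rectangle F) = \prod_ij P ((fun w => Y w ij.1 ij.2) @^-1` F ij).
Proof.
move=> mF; have := iidY.1 [set: 'I_m * 'I_n]%SET F mF.
rewrite (eq_bigl xpredT); last by move=> ij; rewrite inE.
move=> <-; congr (P _); apply/seteqP; split => [w wF ij _|w wF ij]; first exact: wF.
by apply: wF => /=; rewrite inE.
Qed.

(** One entry is independent of all the others taken together: for a fixed event
    B on the entry, both sides are finite measures in the event on the rest, so it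
    suffices to compare them on rectangles, where the product rule applies.
    Overwriting the entry by 0 keeps the rest in the same space of matrices. *)
Lemma entry_independent ij :
  independent_rv P (fun w => setmx (Y w) ij 0%R) (fun w => Y w ij.1 ij.2).
Proof.
move=> A B mA mB.
set Z := fun w => _.
have mZ : measurable_fun setT Z by exact: measurable_fun_setmx.
have mYB : measurable ((fun w => Y w ij.1 ij.2) @^-1` B).
  by rewrite -[X in measurable X]setTI; exact: mY.
set Yij := fun w => Y w ij.1 ij.2.
have PfB : P (Yij @^-1` B) \is a fin_num by exact: fin_num_measure.
pose Z' : {mfun T >-> 'M[R]_(m, n)} := HB.pack Z (isMeasurableFun.Build _ _ _ _ _ mZ).
pose m1 := pushforward (mrestr P mYB) Z'.
have c0 : (0 <= fine (P (Yij @^-1` B)))%R by rewrite fine_ge0.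
pose m2 := mscale (NngNum c0) (distribution P Z').
have -> : P (Z @^-1` A `&` Yij @^-1` B) = m1 A by [].
have -> : P (Z @^-1` A) * P (Yij @^-1` B) = m2 A.
  by rewrite /m2 /mscale /= fineK// muleC.
apply: (measure_unique [set rectangle F | F in
   [set F : 'I_m * 'I_n -> set R | forall ij, measurable (F ij)]] (fun=> setT)) => //.
- exact: measurable_mx_rectangle.
- move=> _ _ [F mF <-] [G mG <-]; exists (fun kl => F kl `&` G kl).
    by move=> kl; exact: measurableI.
  apply/seteqP; split => [M FG|M [FM GM] kl]; last by split.
  by split => kl; have [] := FG kl.
- move=> _; exists (fun=> setT) => //.
  by apply/seteqP; split.
- by rewrite bigcup_const.
- move=> _ [F mF <-].
  change (P (Z @^-1` rectangle F `&` Yij @^-1` B) =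
    (fine (P (Yij @^-1` B)))%:E * P (Z @^-1` rectangle F)).
  rewrite fineK//.
  (* The overwritten entry is the constant 0, which a rectangle may exclude. *)
  have [F0|F0] := pselect (F ij 0%R); last first.
    have -> : Z @^-1` rectangle F = set0.
      apply/seteqP; split => // w /(_ ij) /=.
      by rewrite /Z mxE -surjective_pairing eqxx.
    by rewrite set0I !measure0 mule0.
  pose G C kl := if kl == ij then C else F kl.
  have mG C : measurable C -> forall kl, measurable (G C kl).
    by move=> mC kl; rewrite /G; case: eqP.
  have -> : Z @^-1` rectangle F `&` Yij @^-1` B = Y @^-1` rectangle (G B).
    apply/seteqP; split => [w [FZ BY] kl|w GY].
      rewrite /G; case: eqP => [->//|/eqP nkl].
      by have := FZ kl; rewrite /Z mxE -surjective_pairing (negbTE nkl).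
    split; last by have := GY ij; rewrite /G eqxx.
    move=> kl; rewrite /Z mxE -surjective_pairing.
    by have := GY kl; rewrite /G; case: eqP => // ->.
  have -> : Z @^-1` rectangle F = Y @^-1` rectangle (G setT).
    apply/seteqP; split => [w FZ kl|w GY kl].
      rewrite /G; case: eqP => [->//|/eqP nkl].
      by have := FZ kl; rewrite /Z mxE -surjective_pairing (negbTE nkl).
    rewrite /Z mxE -surjective_pairing.
    by have := GY kl; rewrite /G; case: eqP => // ->.
  rewrite !rectangle_independent//; [|exact: mG|exact: mG].
  rewrite (bigD1 ij)//= [in RHS](bigD1 ij)//= /G eqxx preimage_setT probability_setT mul1e.
  by congr (_ * _); apply: eq_bigr => kl /negbTE ->.
- move=> _; change (P (Z @^-1` setT `&` Yij @^-1` B) < +oo).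
  by rewrite preimage_setT setTI (le_lt_trans (probability_le1 P mYB))// ltry.
Qed.

(** A single entry may be integrated out against its own law, with the rest of the
    matrix kept random.  Every Gaussian computation below is an iteration of this
    step over the entries. *)
Lemma resample (g : 'M[R]_(m, n) -> \bar R) ij :
  measurable_fun setT g -> (forall A, 0 <= g A) ->
  \int[P]_w g (Y w) = \int[P]_w \int[normal_prob mu s]_t g (setmx (Y w) ij t).
Proof.
move=> mg g0.
have mZ : measurable_fun setT (fun w => setmx (Y w) ij 0%R) by exact: measurable_fun_setmx.
pose f (At : 'M[R]_(m, n) * R) := g (setmx At.1 ij At.2).
transitivity (\int[P]_w f (setmx (Y w) ij 0%R, Y w ij.1 ij.2)).
  by apply: eq_integral => w _; rewrite /f /= setmx_setmx setmx_id.
have mf : measurable_fun setT f.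
  by apply: measurableT_comp => //; apply: measurable_fun_setmx.
have f0 At : 0 <= f At by exact: g0.
rewrite (independent_integral mZ (mY ij.1 ij.2) (entry_independent ij) mf f0).
apply: eq_integral => w _; rewrite /f /=.
(* The normal law lives on the copy of R that carries the Lebesgue measure. *)
have mY' : @measurable_fun _ _ T (measurableTypeR R) setT (fun w => Y w ij.1 ij.2).
  exact: mY.
pose Y' : {mfun T >-> measurableTypeR R} := HB.pack (fun w => Y w ij.1 ij.2)
  (isMeasurableFun.Build _ _ _ _ _ mY').
transitivity (\int[distribution P Y']_t g (setmx (Y w) ij t)).
  rewrite ge0_integral_distribution//; last first.
    by apply: measurableT_comp => //; apply: measurable_fun_setmx.
  by apply: eq_integral => w' _; rewrite /= setmx_setmx.
apply: eq_measure_integral => A mA _.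
exact: iidY.2.
Qed.

End iid_matrix.

(** * One-dimensional Gaussian integrals *)

Section lebesgue_translation.
Context {R : realType}.
Local Notation leb := (@lebesgue_measure R).
Local Open Scope ereal_scope.

Lemma measurable_addr (a : R) :
  measurable_fun [set: measurableTypeR R] (fun t : measurableTypeR R => (t + a)%R : measurableTypeR R).
Proof. by apply: measurable_funD => //; exact: measurable_id. Qed.

Lemma lebesgue_measure_translation (a : R) A : measurable A ->
  pushforward leb (fun t : measurableTypeR R => (t + a)%R : measurableTypeR R) A = leb A.
Proof.
move=> mA; pose f := fun t : measurableTypeR R => (t + a)%R : measurableTypeR R.
have mf : measurable_fun [set: measurableTypeR R] f by exact: measurable_addr.
apply/esym/lebesgue_measure_unique => //= _ [[x y]] _ <-.
rewrite /pushforward (_ : _ @^-1` _ = `](x - a)%R, (y - a)%R]%classic).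
  rewrite !lebesgue_measure_itv/= !lte_fin ltrD2r; case: ifP => // _.
  by rewrite -!EFinB; congr _%:E; ring.
by apply/seteqP; split => t /=; rewrite !in_itv /= ltrBlDr lerBrDr.
Qed.

Lemma integral_translation (a : R) (f : measurableTypeR R -> \bar R) :
  measurable_fun setT f -> (forall t, 0 <= f t) ->
  \int[leb]_t f (t + a)%R = \int[leb]_t f t.
Proof.
move=> mf f0; have ma := measurable_addr a.
transitivity (\int[pushforward leb
    (fun t : measurableTypeR R => (t + a)%R : measurableTypeR R)]_t f t).
  by rewrite ge0_integral_pushforward.
by apply: eq_measure_integral => A mA _; exact: lebesgue_measure_translation.
Qed.

End lebesgue_translation.

Section normal_integrals.
Context {R : realType}.
Local Notation leb := (@lebesgue_measure R).
Local Open Scope ereal_scope.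

(** The density of the normal law is its Radon-Nikodym derivative almost
    everywhere, so the change of variables formula for the derivative applies. *)
Lemma integral_normal_prob (mu s : R) (f : measurableTypeR R -> \bar R) :
  measurable_fun setT f -> (forall t, 0 <= f t) ->
  \int[normal_prob mu s]_t f t = \int[leb]_t (f t * (normal_pdf mu s t)%:E).
Proof.
move=> mf f0; have Ndom := normal_prob_dominates mu s.
rewrite -(Radon_Nikodym_SigmaFinite.change_of_variables Ndom)//.
have mpdf : measurable_fun setT (fun t : measurableTypeR R => (normal_pdf mu s t)%:E).
  by apply/measurable_EFinP; exact: measurable_normal_pdf.
have iRN := Radon_Nikodym_SigmaFinite.f_integrable Ndom.
apply: ae_eq_integral => //.
- by apply: emeasurable_funM => //; exact: measurable_int iRN.
- by apply: emeasurable_funM.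
- apply: ae_eqe_mul2l; apply: integral_ae_eq => //.
  by move=> E _ mE; rewrite -Radon_Nikodym_SigmaFinite.f_integral.
Qed.

(** Cameron-Martin in dimension one: completing the square,
    pdf (t - a) = pdf t * exp ((a t - a^2/2) / s^2). *)
Lemma normal_shift (a s : R) (f : measurableTypeR R -> \bar R) : s != 0%R ->
  measurable_fun setT f -> (forall t, 0 <= f t) ->
  \int[normal_prob 0 s]_t f (t + a)%R =
  \int[normal_prob 0 s]_t (f t * (expR ((a * t - a ^+ 2 / 2) / s ^+ 2))%:E).
Proof.
move=> s0 mf f0; have ma := measurable_addr a.
have mexp : measurable_fun setT (fun t : measurableTypeR R =>
    (expR ((a * t - a ^+ 2 / 2) / s ^+ 2))%:E).
  apply/measurable_EFinP; apply: measurableT_comp => //.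
  by apply: measurable_funM => //; apply: measurable_funB.
have mfe : measurable_fun setT (fun t : measurableTypeR R =>
    f t * (expR ((a * t - a ^+ 2 / 2) / s ^+ 2))%:E).
  exact: (emeasurable_funM mf mexp).
rewrite integral_normal_prob//; last exact: measurableT_comp.
rewrite integral_normal_prob//; last first.
  by move=> t; rewrite mule_ge0// lee_fin expR_ge0.
rewrite -[RHS](@integral_translation _ a); last 2 first.
- apply: emeasurable_funM; first exact: mfe.
  by apply/measurable_EFinP; exact: measurable_normal_pdf.
- by move=> t; rewrite !mule_ge0// lee_fin ?expR_ge0 ?normal_pdf_ge0.
apply: eq_integral => t _; rewrite -muleA -EFinM; congr (_ * _%:E).
rewrite normal_pdfE// /normal_fun mulrCA -expRD; congr (_ * expR _)%R.
by field.
Qed.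

(** Completing the square turns the integrand into a multiple of the normal density
    with mean m and standard deviation s / sqrt b.  The outcome is again of the form
    const * exp (- a' c^2), which lets the computation be iterated. *)
Lemma normal_integral_expR_sqr (a c u s : R) : s != 0%R ->
  (0 < 1 + 2 * a * s ^+ 2 * u ^+ 2)%R ->
  \int[normal_prob 0 s]_t (expR (- (a * (c + u * t) ^+ 2)))%:E =
  ((Num.sqrt (1 + 2 * a * s ^+ 2 * u ^+ 2))^-1 *
   expR (- (a * c ^+ 2 / (1 + 2 * a * s ^+ 2 * u ^+ 2))))%:E.
Proof.
set b := (1 + _)%R => s0 b0.
have sb0 : Num.sqrt b != 0%R by rewrite gt_eqF// sqrtr_gt0.
have s'0 : (s / Num.sqrt b != 0)%R by rewrite mulf_neq0// invr_neq0.
pose m := (- (2 * a * c * u * s ^+ 2 / b))%R.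
rewrite integral_normal_prob; last 2 first.
- apply/measurable_EFinP; apply: measurableT_comp => //.
  apply: measurableT_comp => //; apply: measurable_funM => //.
  by apply: measurable_funX; apply: measurable_funD => //; apply: measurable_funM.
- by move=> t; rewrite lee_fin expR_ge0.
pose C := ((Num.sqrt b)^-1 * expR (- (a * c ^+ 2 / b)))%R.
transitivity (\int[leb]_t (C%:E * (normal_pdf m (s / Num.sqrt b) t)%:E)); last first.
  rewrite ge0_integralZl_EFin//.
  - by rewrite integral_normal_pdf mule1.
  - by move=> t _; rewrite lee_fin normal_pdf_ge0.
  - by apply/measurable_EFinP; exact: measurable_normal_pdf.
  - by rewrite mulr_ge0 ?expR_ge0// invr_ge0.
apply: eq_integral => t _; rewrite -!EFinM; congr _%:E.
rewrite !normal_pdfE// /normal_fun /C.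
have -> : normal_peak (s / Num.sqrt b) = (Num.sqrt b * normal_peak s)%R.
  rewrite /normal_peak expr_div_n sqr_sqrtr ?ltW//.
  rewrite -mulrnAr -mulrnAr mulrAC sqrtrM; last first.
    by rewrite mulr_ge0 ?sqr_ge0// mulrn_wge0// pi_ge0.
  by rewrite sqrtrV ?ltW// invfM invrK mulrC.
rewrite mulrCA mulrACA mulKf// -!expRD; congr (_ * expR _)%R.
rewrite exprMn exprVn sqr_sqrtr ?ltW// /m.
have bN0 : b != 0%R by rewrite gt_eqF.
by rewrite /b in bN0 *; field; rewrite ?bN0 ?s0.
Qed.

End normal_integrals.

(** * Gaussian matrices: shifts, Laplace transform, concentration *)

Section probability_bounds.
Context d (T : measurableType d) (R : realType) (P : probability T R).
Local Open Scope ereal_scope.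

Lemma probability_le_integral (A : set T) (f : T -> R) : measurable A ->
  measurable_fun setT f -> (forall w, 0 <= f w)%R -> (forall w, A w -> 1 <= f w)%R ->
  P A <= \int[P]_w (f w)%:E.
Proof.
move=> mA mf f0 f1; rewrite -[leLHS]mul1e -(integral_cst P mA 1).
apply: (@le_trans _ _ (\int[P]_(w in A) (f w)%:E)).
  apply: ge0_le_integral => //=.
  by apply/measurable_funTS/measurable_EFinP.
apply: ge0_subset_integral => //.
- exact/measurable_EFinP.
- by move=> w _; rewrite lee_fin.
Qed.

End probability_bounds.

Section gaussian_matrix.
Context d (T : measurableType d) (R : realType) (P : probability T R) (m n : nat).
Context (Y : {RV P >-> 'M[R]_(m, n)}) (s : R).
Hypothesis iidY : iid_normal_entries 0 s Y.
Hypothesis s0 : s != 0.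
Local Open Scope ereal_scope.

Section shift.
Context (M : 'M[R]_(m, n)).
Implicit Types (S : {set 'I_m * 'I_n}).

Let tilt S (A : 'M[R]_(m, n)) : R :=
  expR ((\sum_(ij in S) (M ij.1 ij.2 * A ij.1 ij.2 - M ij.1 ij.2 ^+ 2 / 2)) / s ^+ 2).

Let trunc S : 'M[R]_(m, n) := \matrix_(i, j) if (i, j) \in S then M i j else 0%R.

Let measurable_tilt S : measurable_fun setT (tilt S).
Proof.
apply: measurableT_comp => //; apply: measurable_funM => //.
apply: measurable_sum_cond => ij _.
by apply: measurable_funB => //; apply: measurable_funM => //; exact: measurable_entry.
Qed.

(* Induction over the set of shifted entries: the new entry is resampled, and the
   one-dimensional shift is applied to it alone. *)
Let shift_partial S (f : 'M[R]_(m, n) -> \bar R) :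
  measurable_fun setT f -> (forall A, 0 <= f A) ->
  \int[P]_w f (Y w + trunc S)%R = \int[P]_w (f (Y w) * (tilt S (Y w))%:E).
Proof.
have mtilt S' : measurable_fun setT (fun A => (tilt S' A)%:E).
  exact/measurable_EFinP.
have tilt0 S' A : 0 <= (tilt S' A)%:E by rewrite lee_fin expR_ge0.
have [k] := ubnP #|S|; elim: k S f => // k IH S f; rewrite ltnS => Sk mf f0.
have [->|[ij ijS]] := set_0Vmem S.
  apply: eq_integral => w _; rewrite /tilt big_set0 mul0r expR0 mule1; congr f.
  by apply/matrixP => i j; rewrite !mxE inE addr0.
set S' := (S :\ ij)%SET; set a := M ij.1 ij.2.
have ijS' : ij \notin S' by rewrite !inE eqxx.
have cS' : (#|S'| < k)%N by move: Sk; rewrite (cardsD1 ij S) ijS.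
pose g A := f (setmx A ij (A ij.1 ij.2 + a)).
have mg : measurable_fun setT g.
  apply: measurableT_comp => //; apply: measurable_fun_setmx => //.
  by apply: measurable_funD => //; exact: measurable_entry.
transitivity (\int[P]_w g (Y w + trunc S')%R).
  apply: eq_integral => w _; congr f; apply/matrixP => i j; rewrite !mxE /S' !inE.
  rewrite -surjective_pairing eqxx /= addr0 /a.
  by case: eqP ijS => [<-|//] ->.
rewrite (IH S' g cS' mg); last by move=> A; exact: f0.
rewrite (resample (g := fun A => g A * (tilt S' A)%:E) iidY ij); last 2 first.
- exact: (emeasurable_funM mg (mtilt S')).
- by move=> A; apply: mule_ge0; [exact: f0|exact: tilt0].
rewrite [RHS](resample (g := fun A => f A * (tilt S A)%:E) iidY ij); last 2 first.
- exact: (emeasurable_funM mf (mtilt S)).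
- by move=> A; apply: mule_ge0; [exact: f0|exact: tilt0].
apply: eq_integral => w _.
have msetmx : measurable_fun [set: measurableTypeR R] (fun t => setmx (Y w) ij t).
  by apply: measurable_fun_setmx => //; exact: measurable_id.
have mfw : measurable_fun [set: measurableTypeR R] (fun t : measurableTypeR R =>
    f (setmx (Y w) ij t)) := measurableT_comp mf msetmx.
have mfwa : measurable_fun [set: measurableTypeR R] (fun t : measurableTypeR R =>
    f (setmx (Y w) ij (t + a)%R)).
  have msa : measurable_fun [set: measurableTypeR R] (fun t : measurableTypeR R =>
    setmx (Y w) ij (t + a)%R).
    by apply: measurable_fun_setmx => //; exact: measurable_addr.
  exact: (measurableT_comp mf msa).
have tiltS' t : tilt S' (setmx (Y w) ij t) = tilt S' (Y w).
  rewrite /tilt (eq_bigr (fun kl => M kl.1 kl.2 * Y w kl.1 kl.2 - M kl.1 kl.2 ^+ 2 / 2)%R)//.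
  move=> kl klS'; rewrite mxE -surjective_pairing.
  by case: eqP klS' => // ->; rewrite (negbTE ijS').
transitivity (\int[normal_prob 0 s]_t ((tilt S' (Y w))%:E * f (setmx (Y w) ij (t + a)))).
  apply: eq_integral => t _; rewrite tiltS' muleC /g setmx_setmx.
  by rewrite mxE -surjective_pairing eqxx.
rewrite ge0_integralZl_EFin//; last first.
  by rewrite expR_ge0.
rewrite (@normal_shift _ a s (fun t => f (setmx (Y w) ij t)))//.
rewrite -ge0_integralZl_EFin ?expR_ge0//; last 2 first.
- by move=> t _; rewrite mule_ge0// lee_fin expR_ge0.
- apply: (emeasurable_funM mfw); apply/measurable_EFinP; apply: measurableT_comp => //.
  by apply: measurable_funM => //; apply: measurable_funB.
apply: eq_integral => t _; rewrite muleCA -EFinM; congr (_ * _%:E).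
rewrite -(tiltS' t) /tilt [in RHS](big_setD1 ij)//= [LHS]mulrC -expRD -mulrDl.
by rewrite [setmx _ _ _ ij.1 _]mxE -surjective_pairing eqxx.
Qed.

Lemma gaussian_shift (f : 'M[R]_(m, n) -> \bar R) :
  measurable_fun setT f -> (forall A, 0 <= f A) ->
  \int[P]_w f (Y w + M)%R = \int[P]_w (f (Y w) *
    (expR ((\sum_ij (M ij.1 ij.2 * Y w ij.1 ij.2 - M ij.1 ij.2 ^+ 2 / 2)) / s ^+ 2))%:E).
Proof.
move=> mf f0; have := shift_partial [set: 'I_m * 'I_n]%SET mf f0.
have -> : trunc [set: 'I_m * 'I_n]%SET = M by apply/matrixP => i j; rewrite mxE inE.
move=> ->; apply: eq_integral => w _; rewrite /tilt (eq_bigl xpredT)// => ij.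
by rewrite inE.
Qed.

End shift.

Section laplace.
Context (u : 'cV[R]_n) (a : R).
Hypothesis b0 : (0 < 1 + 2 * a * s ^+ 2 * sqnorm u)%R.
Implicit Types (S : {set 'I_m * 'I_n}).

(* State of the computation after the entries in S have been integrated out: row i
   has the remaining linear part c S A i, and the exponent a has become
   a / b S i, with b S i accounting for the variance already absorbed. *)
Let b S i : R := (1 + 2 * a * s ^+ 2 * \sum_(j | (i, j) \in S) u j 0 ^+ 2)%R.
Let c S (A : 'M[R]_(m, n)) i : R := \sum_(j | (i, j) \notin S) A i j * u j 0.
Let G S A : R := \prod_i ((Num.sqrt (b S i))^-1 * expR (- (a / b S i * c S A i ^+ 2))).

Let bS_gt0 S i : (0 < b S i)%R.
Proof.
have v0 : (0 <= \sum_(j | (i, j) \in S) u j 0 ^+ 2)%R by apply: sumr_ge0 => j _; exact: sqr_ge0.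
have [a0|a0] := leP 0%R a.
  by rewrite /b ltr_pwDl// mulr_ge0// mulr_ge0 ?sqr_ge0// mulr_ge0.
apply: (lt_le_trans b0); rewrite /b lerD2l.
apply: ler_wnM2l.
  by rewrite mulr_le0_ge0 ?sqr_ge0// pmulr_rle0// ltW.
rewrite /sqnorm [leLHS]big_mkcond; apply: ler_sum => j _.
by case: ifP => // _; exact: sqr_ge0.
Qed.

Let G_ge0 S A : (0 <= G S A)%R.
Proof. by apply: prodr_ge0 => i _; rewrite mulr_ge0 ?expR_ge0// invr_ge0. Qed.

Let measurable_G S : measurable_fun setT (G S).
Proof.
apply: measurable_prod => i _; apply: measurable_funM => //.
apply: measurableT_comp => //; apply: measurableT_comp => //.
apply: measurable_funM => //; apply: measurable_funX.
apply: measurable_sum_cond => j _.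
by apply: measurable_funM => //; exact: measurable_entry.
Qed.

Let G_step S ij A : ij \notin S ->
  \int[normal_prob 0 s]_t (G S (setmx A ij t))%:E = (G (ij |: S)%SET A)%:E.
Proof.
case: ij => i j ijS.
have cE t : c S (setmx A (i, j) t) i = (c ((i, j) |: S)%SET A i + u j 0 * t)%R.
  rewrite /c (bigD1 j)//= mxE eqxx mulrC addrC; congr (_ + _)%R.
  apply: eq_big => [l|l /andP[_ /negbTE lj]].
    by rewrite !inE negb_or xpair_eqE eqxx andbC.
  by rewrite mxE xpair_eqE lj andbF.
have cN t i' : i' != i -> c S (setmx A (i, j) t) i' = c ((i, j) |: S)%SET A i'.
  move=> /negbTE i'i; apply: eq_big => [l|l _]; first by rewrite !inE xpair_eqE i'i.
  by rewrite mxE xpair_eqE i'i.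
have bN i' : i' != i -> b S i' = b ((i, j) |: S)%SET i'.
  move=> /negbTE i'i; rewrite /b; congr (_ + _ * _)%R; apply: eq_bigl => l.
  by rewrite !inE xpair_eqE i'i.
have bE : b ((i, j) |: S)%SET i = (b S i + 2 * a * s ^+ 2 * u j 0 ^+ 2)%R.
  rewrite /b (bigD1 j) /=; last by rewrite !inE eqxx.
  rewrite (eq_bigl (fun l => (i, l) \in S)); first by rewrite mulrDr addrCA addrC.
  move=> l; rewrite !inE xpair_eqE eqxx /=; case: eqP => [->|_] /=; last by rewrite andbT.
  by rewrite (negbTE ijS).
set C := (\prod_(i' | i' != i) ((Num.sqrt (b ((i, j) |: S)%SET i'))^-1 *
   expR (- (a / b ((i, j) |: S)%SET i' * c ((i, j) |: S)%SET A i' ^+ 2))))%R.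
have C0 : (0 <= C)%R.
  by apply: prodr_ge0 => i' _; rewrite mulr_ge0 ?expR_ge0// invr_ge0.
have bS0 := bS_gt0 S i.
have mq : measurable_fun [set: measurableTypeR R] (fun t : measurableTypeR R =>
    (expR (- (a / b S i * (c ((i, j) |: S)%SET A i + u j 0 * t) ^+ 2)))%:E).
  apply/measurable_EFinP; apply: measurableT_comp => //.
  apply: measurableT_comp => //; apply: measurable_funM => //.
  by apply: measurable_funX; apply: measurable_funD => //; apply: measurable_funM.
transitivity (\int[normal_prob 0 s]_t (((C / Num.sqrt (b S i))%:E) *
    (expR (- (a / b S i * (c ((i, j) |: S)%SET A i + u j 0 * t) ^+ 2)))%:E)).
  apply: eq_integral => t _; rewrite -EFinM /G (bigD1 i)//= cE.
  rewrite (_ : \prod_(i' | i' != i) _ = C)%R; first by congr _%:E; ring.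
  by apply: eq_bigr => i' i'i; rewrite cN// bN.
rewrite ge0_integralZl_EFin ?divr_ge0//.
have beq : (1 + 2 * (a / b S i) * s ^+ 2 * u j 0 ^+ 2 = b ((i, j) |: S)%SET i / b S i)%R.
  by rewrite bE; field; rewrite gt_eqF.
rewrite normal_integral_expR_sqr// beq; last by rewrite divr_gt0.
rewrite -EFinM; congr _%:E.
rewrite /G [RHS](bigD1 i)//= -/C mulrC.
rewrite sqrtrM ?ltW// sqrtrV ?ltW//.
have sb0 : Num.sqrt (b S i) != 0%R by rewrite gt_eqF// sqrtr_gt0.
have sb1 : Num.sqrt (b ((i, j) |: S)%SET i) != 0%R by rewrite gt_eqF// sqrtr_gt0.
rewrite (_ : a / b S i * c ((i, j) |: S)%SET A i ^+ 2 / (b ((i, j) |: S)%SET i / b S i) =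
  a / b ((i, j) |: S)%SET i * c ((i, j) |: S)%SET A i ^+ 2)%R; last first.
  by field; rewrite !gt_eqF.
by field; rewrite sb0 sb1.
Qed.

(** |Y u|^2 is s^2 |u|^2 times a chi-square variable with m degrees of freedom; this
    is its Laplace transform.  Negative a is allowed as long as the transform is
    finite, so that both tails can be bounded. *)
Lemma gaussian_laplace :
  \int[P]_w (expR (- (a * sqnorm (Y w *m u))))%:E =
  ((Num.sqrt (1 + 2 * a * s ^+ 2 * sqnorm u))^-1 ^+ m)%:E.
Proof.
have GE S : \int[P]_w (G S (Y w))%:E = \int[P]_w (G finset.set0 (Y w))%:E.
  have [k] := ubnP #|S|; elim: k S => [S|k IH S]; first by rewrite ltn0.
  rewrite ltnS => Sk.
  have [->//|[ij ijS]] := set_0Vmem S.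
  rewrite -(IH (S :\ ij)%SET); last by move: Sk; rewrite (cardsD1 ij S) ijS.
  rewrite [RHS](resample (g := fun A => (G (S :\ ij)%SET A)%:E) iidY ij); last 2 first.
  - exact/measurable_EFinP.
  - by move=> A; rewrite lee_fin.
  apply: eq_integral => w _; rewrite G_step ?inE ?eqxx//.
  by rewrite finset.setD1K.
transitivity (\int[P]_w (G finset.set0 (Y w))%:E).
  apply: eq_integral => w _; congr _%:E; rewrite /G.
  have -> : (a * sqnorm (Y w *m u) = \sum_i a * c finset.set0 (Y w) i ^+ 2)%R.
    rewrite /sqnorm mulr_sumr; apply: eq_bigr => i _; rewrite /c mxE.
    by congr (_ * _ ^+ 2)%R; apply: eq_bigl => j; rewrite inE.
  rewrite -sumrN expR_sum; apply: eq_bigr => i _.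
  have -> : b finset.set0 i = 1%R by rewrite /b big_pred0 ?mulr0 ?addr0// => j; rewrite inE.
  by rewrite sqrtr1 invr1 mul1r mulr1.
rewrite -(GE finset.setT).
have -> : (fun w => (G finset.setT (Y w))%:E) =
    cst ((Num.sqrt (1 + 2 * a * s ^+ 2 * sqnorm u))^-1 ^+ m)%:E.
  apply/funext => w; congr _%:E; rewrite /G -[in RHS](card_ord m) -prodr_const.
  apply: eq_bigr => i _; rewrite (_ : c finset.setT (Y w) i = 0%R); last first.
    by rewrite /c big_pred0// => j; rewrite inE.
  rewrite expr0n mulr0 oppr0 expR0 mulr1 /b /sqnorm.
  by rewrite (eq_bigl xpredT)// => j; rewrite inE.
by rewrite integral_cst// [X in _ * X]probability_setT mule1.
Qed.

End laplace.

End gaussian_matrix.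

Section gaussian_norm.
Context d (T : measurableType d) (R : realType) (P : probability T R) (m n : nat).
Context (Y : {RV P >-> 'M[R]_(m, n)}).

(** Chernoff bound for both tails at once: positive kap says that |Y u|^2 is rarely
    below (1 - 2 kap) |u|^2, negative kap that it is rarely above
    (1 + 2 |kap|) |u|^2. *)
Lemma sqnorm_mulmx_tail (u : 'cV[R]_n) (kap : R) : (0 < m)%N ->
  iid_normal_entries 0 (Num.sqrt (1 / m%:R)) Y -> 0 < sqnorm u -> `|kap| <= 1 / 4 ->
  (P [set w | kap * sqnorm (Y w *m u) <= kap * (1 - 2 * kap) * sqnorm u]%R <=
   (expR (- (m%:R * kap ^+ 2 / 4)))%:E)%E.
Proof.
move=> m0 iidY u0; rewrite ler_norml => /andP[k1 k2].
have mR0 : 0 < m%:R :> R by rewrite ltr0n.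
have s0 : Num.sqrt (1 / m%:R) != 0 :> R by rewrite gt_eqF// sqrtr_gt0 divr_gt0.
(* This exponent makes the Laplace transform equal to (1 + kap)^(-m/2). *)
pose a := kap * m%:R / (2 * sqnorm u).
have bE : 1 + 2 * a * Num.sqrt (1 / m%:R) ^+ 2 * sqnorm u = 1 + kap.
  rewrite sqr_sqrtr; last by rewrite divr_ge0// ltW.
  by rewrite /a; field; rewrite !gt_eqF.
have b0 : 0 < 1 + kap by lra.
have mYu : measurable_fun setT (fun w => sqnorm (Y w *m u)).
  by apply: measurable_fun_sqnorm; apply: measurable_fun_mulmx.
pose f w := expR (a * (1 - 2 * kap) * sqnorm u) * expR (- (a * sqnorm (Y w *m u))).
have mexp : measurable_fun setT (fun w => expR (- (a * sqnorm (Y w *m u)))).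
  apply: measurableT_comp => //; apply: measurableT_comp => //.
  exact: measurable_funM.
apply: (@le_trans _ _ (\int[P]_w (f w)%:E)%E).
  apply: probability_le_integral.
  - by apply: measurable_le_set => //; apply: measurable_funM.
  - exact: measurable_funM.
  - by move=> w; rewrite mulr_ge0// expR_ge0.
  - move=> w /= le_kap; rewrite /f -expRD -[leLHS]expR0 ler_expR.
    have -> : a * (1 - 2 * kap) * sqnorm u - a * sqnorm (Y w *m u) =
        (kap * (1 - 2 * kap) * sqnorm u - kap * sqnorm (Y w *m u)) *
        (m%:R / (2 * sqnorm u)).
      by rewrite /a; field; rewrite gt_eqF.
    by rewrite mulr_ge0// ?subr_ge0// divr_ge0 ?mulr_ge0// ltW.
rewrite /f; under eq_integral do rewrite EFinM.
rewrite ge0_integralZl_EFin ?expR_ge0//; last exact/measurable_EFinP.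
rewrite (gaussian_laplace iidY s0) bE// -EFinM lee_fin.
have -> : a * (1 - 2 * kap) * sqnorm u = (kap * (1 - 2 * kap) / 2) * m%:R.
  by rewrite /a; field; rewrite gt_eqF.
have -> : - (m%:R * kap ^+ 2 / 4) = (- (kap ^+ 2 / 4)) * m%:R.
  by field.
rewrite !expRM_natr -exprMn; apply: lerXn2r; rewrite ?nnegrE ?mulr_ge0 ?expR_ge0 ?invr_ge0 ?sqrtr_ge0//.
(* ln (1 + kap) >= x, from 1 - x <= exp (- x). *)
pose x := kap / (1 + kap).
have sq : expR (x / 2) <= Num.sqrt (1 + kap).
  rewrite -(@ler_pXn2r _ 2)// ?nnegrE ?expR_ge0 ?sqrtr_ge0//.
  rewrite sqr_sqrtr; last exact: ltW.
  rewrite -expRM_natr divfK//.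
  have := expR_ge1Dx (- x); rewrite expRN.
  have -> : 1 - x = (1 + kap)^-1 by rewrite /x; field; rewrite gt_eqF.
  by rewrite lef_pV2 ?posrE ?expR_gt0.
rewrite ler_pdivrMr ?sqrtr_gt0//.
apply: (@le_trans _ _ (expR (- (kap ^+ 2 / 4)) * expR (x / 2))); last first.
  by rewrite ler_pM2l ?expR_gt0.
rewrite -expRD ler_expR -subr_ge0.
have -> : - (kap ^+ 2 / 4) + x / 2 - kap * (1 - 2 * kap) / 2 =
    kap ^+ 2 * ((1 + 3 * kap) / (4 * (1 + kap))).
  by rewrite /x; field; rewrite gt_eqF.
by rewrite mulr_ge0 ?sqr_ge0// divr_ge0; lra.
Qed.

End gaussian_norm.

Section gaussian_change_of_measure.
Context d (T : measurableType d) (R : realType) (P : probability T R) (n : nat).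
Context (z : {RV P >-> 'cV[R]_n}) (sigma : R).
Hypothesis iidz : iid_normal_entries 0 sigma z.
Hypothesis sigma_gt0 : 0 < sigma.

(* Log-likelihood ratio at y between the means m and 0. *)
Let logL (m y : 'cV[R]_n) : R := (\sum_i m i 0 * y i 0 - sqnorm m / 2) / sigma ^+ 2.

Let measurable_logL m : measurable_fun setT (fun y => logL m y).
Proof.
apply: measurable_funM => //; apply: measurable_funB => //; apply: measurable_sum => i.
by apply: measurable_funM => //; exact: measurable_entry.
Qed.

Let shift_cV (m : 'cV[R]_n) (f : 'cV[R]_n -> \bar R) :
  measurable_fun setT f -> (forall y, (0 <= f y)%E) ->
  (\int[P]_w f (z w + m)%R = \int[P]_w (f (z w) * (expR (logL m (z w)))%:E))%E.
Proof.
move=> mf f0; rewrite (@gaussian_shift _ _ _ _ _ _ z sigma iidz (lt0r_neq0 sigma_gt0) m f mf f0).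
apply: eq_integral => w _.
have -> : \sum_ij (m ij.1 ij.2 * z w ij.1 ij.2 - m ij.1 ij.2 ^+ 2 / 2) =
    \sum_i m i 0 * z w i 0 - sqnorm m / 2.
  rewrite -(pair_bigA _ (fun i j => m i j * z w i j - m i j ^+ 2 / 2)) /=.
  rewrite /sqnorm mulr_suml -sumrB; apply: eq_bigr => i _.
  by rewrite big_ord1.
by [].
Qed.

(** Probabilities under the shifted law are controlled by those under the centred
    law: the likelihood ratio L is at most e^tau, except where it is at most
    L^(1+s) e^(-s tau), and the power L^(1+s) is, up to the constant
    exp (s (1+s) |m|^2 / (2 sigma^2)), the likelihood ratio of the shift
    (1+s) m. *)
Lemma shift_probability_le (m : 'cV[R]_n) (B : set 'cV[R]_n) (tau s : R) :
  measurable B -> 0 <= s ->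
  (P [set w | B (z w + m)]%R <= (expR tau)%:E * P [set w | B (z w)] +
   (expR (s * (1 + s) * (sqnorm m / (2 * sigma ^+ 2)) - s * tau))%:E)%E.
Proof.
move=> mB s0.
have mBf (g : T -> 'cV[R]_n) : measurable_fun setT g -> measurable [set w | B (g w)].
  by move=> mg; rewrite -[X in measurable X]setTI; exact: mg.
have mz : measurable_fun setT z by [].
have mzm : measurable_fun setT (fun w => z w + m) by exact: measurable_fun_addmx.
have mind : measurable_fun setT (fun y : 'cV[R]_n => (\1_B y)%:E : \bar R).
  by apply/measurable_EFinP; exact: measurable_indic.
have mL c b : measurable_fun setT (fun y : 'cV[R]_n => (c * expR (logL b y))%:E).
  by apply/measurable_EFinP; apply: measurable_funM => //; exact: measurableT_comp.
have mLz c b : measurable_fun setT (fun w => (c * expR (logL b (z w)))%:E).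
  exact: (measurableT_comp (mL c b) mz).
have mLz1 b : measurable_fun setT (fun w => (expR (logL b (z w)))%:E).
  by have := mLz 1 b; under eq_fun do rewrite mul1r.
have mindz : measurable_fun setT (fun w => (\1_B (z w))%:E : \bar R).
  exact: (measurableT_comp mind mz).
have PE (g : T -> 'cV[R]_n) : measurable_fun setT g ->
    (P [set w | B (g w)] = \int[P]_w (\1_B (g w))%:E)%E.
  move=> mg; rewrite -[in LHS](setIT [set w | B (g w)]) -integral_indic//.
  exact: mBf.
rewrite !PE// (shift_cV m mind); last by move=> y; rewrite lee_fin.
pose e := s * (1 + s) * (sqnorm m / (2 * sigma ^+ 2)).
have logLs y : (1 + s) * logL m y = logL ((1 + s) *: m) y + e.
  have dots : \sum_i ((1 + s) *: m) i 0 * y i 0 = (1 + s) * \sum_i m i 0 * y i 0.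
    by rewrite mulr_sumr; apply: eq_bigr => i _; rewrite mxE mulrA.
  by rewrite /logL sqnormZ dots /e; field; rewrite gt_eqF.
have tot : (\int[P]_w (expR (e - s * tau) * expR (logL ((1 + s) *: m) (z w)))%:E =
    (expR (e - s * tau))%:E)%E.
  under eq_integral do rewrite EFinM.
  rewrite ge0_integralZl_EFin ?expR_ge0//.
  have := @shift_cV ((1 + s) *: m) (cst 1%E) (measurable_cst _) (fun=> @lee01 R).
  rewrite /= integral_cst// [X in (1 * X)%E]probability_setT mule1 => e1.
  under eq_integral do rewrite -[(expR _)%:E]mul1e.
  by rewrite -e1 mule1.
rewrite -tot -ge0_integralZl_EFin ?expR_ge0//.
have mtau : measurable_fun setT (fun w => (expR tau)%:E * (\1_B (z w))%:E)%E.
  exact: emeasurable_funM.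
rewrite -ge0_integralD//.
apply: ge0_le_integral => //; [exact: emeasurable_funM|exact: emeasurable_funD|].
move=> w _; rewrite -!EFinM -EFinD lee_fin -expRD.
have -> : e - s * tau + logL ((1 + s) *: m) (z w) = (1 + s) * logL m (z w) - s * tau.
  by rewrite logLs; ring.
rewrite indicE; case: (z w \in B); rewrite ?mul0r ?mulr0 ?add0r ?expR_ge0// !mul1r mulr1.
have [le_tau|/ltW ge_tau] := leP (logL m (z w)) tau.
  by rewrite -[leLHS]addr0 lerD ?expR_ge0// ler_expR.
rewrite -[leLHS]add0r lerD ?expR_ge0// ler_expR.
have : 0 <= s * (logL m (z w) - tau) by rewrite mulr_ge0// subr_ge0.
lra.
Qed.

End gaussian_change_of_measure.

(** * Combinatorics of block selections *)

Section packing.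
Context {k q : nat}.
Local Notation F := {ffun 'I_k -> 'I_q}.
Implicit Types (J : F) (A B : {set F}).

Definition overlap J J' : nat := #|[set b | J b == J' b]%SET|.

Lemma overlapC J J' : overlap J J' = overlap J' J.
Proof. by rewrite /overlap; apply: eq_card => b; rewrite !inE eq_sym. Qed.

Lemma overlapJ J : overlap J J = k.
Proof.
rewrite /overlap; have -> : [set b | J b == J b]%SET = finset.setT.
  by apply/finset.setP => b; rewrite !inE eqxx.
by rewrite cardsT card_ord.
Qed.

(** If pairwise far families inside A are small, a maximal such family B is a short
    list of candidates: every J in A is close to a member of B.  Only the union
    S b of the values that the candidates take on each block b is kept, because it
    bounds what can be guessed about J b. *)
Lemma packing_cover (far : rel F) A (M : nat) : symmetric far ->
  (forall B, B \subset A -> (forall J J', J \in B -> J' \in B -> J != J' -> far J J') ->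
    (#|B| <= M)%N) ->
  {S : 'I_k -> {set 'I_q} | (forall b, (#|S b| <= M)%N) &
    forall J, J \in A -> exists J', (J = J' \/ ~~ far J J') /\
      (overlap J J' <= #|[set b | J b \in S b]%SET|)%N}.
Proof.
move=> farC packM.
pose farset B := (B \subset A) && [forall J in B, forall J' in B, (J != J') ==> far J J'].
have far0 : farset finset.set0.
  rewrite /farset finset.sub0set; apply/forallP => J; by rewrite inE.
case: (arg_maxnP (fun B : {set F} => #|B|) far0) => B /andP[BA farB] maxB.
have {}farB J J' : J \in B -> J' \in B -> J != J' -> far J J'.
  move=> JB J'B; apply/implyP.
  by move/forallP/(_ J)/implyP/(_ JB)/forallP/(_ J')/implyP/(_ J'B): farB.
exists (fun b => [set (J : F) b | J in B]%SET) => [b|J JA].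
  by rewrite (leq_trans (leq_imset_card _ _))// packM.
have cover J' : J' \in B -> (overlap J J' <= #|[set b | J b \in [set (J : F) b | J in B]]%SET|)%N.
  move=> J'B; apply: subset_leq_card; apply/fintype.subsetP => b; rewrite !inE => /eqP ->.
  by apply/imsetP; exists J'.
have [JB|JB] := boolP (J \in B); first by exists J; split; [left|exact: cover].
have [J' J'B nfar] : exists2 J', J' \in B & ~~ far J J'.
  apply/exists_inP; apply: contraT; rewrite negb_exists_in => /forall_inP allfar.
  have : farset (J |: B)%SET.
    apply/andP; split.
      by rewrite finset.subUset finset.sub1set JA.
    apply/forall_inP => J1 /finset.setU1P[->|J1B]; apply/forall_inP => J2 /finset.setU1P[->|J2B];
      apply/implyP.
    - by rewrite eqxx.
    - by move=> _; have := allfar _ J2B; rewrite negbK.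
    - by move=> _; have := allfar _ J1B; rewrite negbK farC.
    - exact: farB.
  by move/maxB => /=; rewrite cardsU1 JB add1n ltnn.
by exists J'; split; [right|exact: cover].
Qed.

Definition set_coord J (b : 'I_k) (j : 'I_q) : F :=
  [ffun c => if c == b then j else J c].

(** Guessing one coordinate of a uniform J by a set of M values that does not depend
    on this coordinate succeeds with probability at most M / q.  Exchanging J b
    with an independent uniform value j turns the event J b in h J into
    j in h J. *)
Lemma card_hit_coord (b : 'I_k) (M : nat) (h : F -> {set 'I_q}) :
  (forall J j, h (set_coord J b j) = h J) -> (forall J, (#|h J| <= M)%N) ->
  (q * #|[set J : F | J b \in h J]%SET| <= M * #|{: F}|)%N.
Proof.
move=> hinv hM.
pose swap (Jj : F * 'I_q) := (set_coord Jj.1 b Jj.2, Jj.1 b).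
have swapK : involutive swap.
  move=> [J j]; rewrite /swap /= ffunE eqxx; congr pair.
  by apply/ffunP => c; rewrite !ffunE; case: eqP => // ->.
have -> : (q * #|[set J : F | J b \in h J]%SET| =
    #|[set Jj : F * 'I_q | Jj.1 b \in h Jj.1]%SET|)%N.
  have -> : [set Jj : F * 'I_q | Jj.1 b \in h Jj.1]%SET =
      finset.setX [set J : F | J b \in h J]%SET [set: 'I_q]%SET.
    by apply/finset.setP => -[J j]; rewrite !inE /= andbT.
  by rewrite cardsX cardsT card_ord mulnC.
rewrite -(card_imset _ (inv_inj swapK)).
apply: (@leq_trans #|[set Jj : F * 'I_q | Jj.2 \in h Jj.1]%SET|).
  apply: subset_leq_card; apply/fintype.subsetP => _ /imsetP[[J j]] /[!inE] /= Jh ->.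
  by rewrite /= hinv.
rewrite -sum1dep_card -(pair_big_dep xpredT (fun J j => j \in h J) (fun _ _ => 1%N)) /=.
rewrite mulnC -sum_nat_const; apply: leq_sum => J _.
by rewrite sum1dep_card cardsE.
Qed.

End packing.

(** * Separated points in a Euclidean ball *)

Section euclidean_packing.
Context {R : realType} {n : nat} {I : finType}.

(** Comparing with the centre v, the sum of |x i - x j|^2 over all pairs is
    2 N sum |v - x i|^2 - 2 |sum (v - x i)|^2, hence at most 2 N^2 r.  So if
    2 r < D the number N of points is bounded. *)
Lemma ball_packing (x : I -> 'cV[R]_n) (v : 'cV[R]_n) (B : {set I}) (r D : R) :
  (forall i, i \in B -> sqnorm (v - x i) <= r) ->
  (forall i j, i \in B -> j \in B -> i != j -> D <= sqnorm (x i - x j)) ->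
  B != finset.set0 -> (#|B|%:R - 1) * D <= 2 * #|B|%:R * r.
Proof.
move=> ball sep B0; pose N : R := #|B|%:R.
have N0 : 0 < N by rewrite ltr0n card_gt0.
have sum_sep : N * ((N - 1) * D) <= \sum_(i in B) \sum_(j in B) sqnorm (x i - x j).
  have -> : N * ((N - 1) * D) = \sum_(i in B) (N - 1) * D.
    by rewrite sumr_const mulr_natl.
  apply: ler_sum => i iB; rewrite (bigD1 i)//= -[leLHS]add0r; apply: lerD.
    exact: sqnorm_ge0.
  have -> : (N - 1) * D = \sum_(j in B :\ i) D.
    rewrite sumr_const -mulr_natl; congr (_ * _).
    by rewrite /N (cardsD1 i) iB natrD addrC addKr.
  rewrite [leRHS](eq_bigl (mem (B :\ i)%SET)); last by move=> j; rewrite !inE andbC.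
  apply: ler_sum => j /[!inE] /andP[ji jB]; apply: sep => //; by rewrite eq_sym.
have sum_ball : \sum_(i in B) \sum_(j in B) sqnorm (x i - x j) <= 2 * N * (N * r).
  apply: (@le_trans _ _ (2 * N * \sum_(i in B) sqnorm (v - x i))); last first.
    rewrite ler_pM2l ?mulr_gt0// /N mulr_natl -sumr_const.
    by apply: ler_sum => i iB; exact: ball.
  pose a i l := (v - x i) l 0.
  have -> : \sum_(i in B) \sum_(j in B) sqnorm (x i - x j) =
      \sum_l \sum_(i in B) \sum_(j in B) (a j l - a i l) ^+ 2.
    rewrite [RHS]exchange_big; apply: eq_bigr => i _; rewrite [RHS]exchange_big.
    apply: eq_bigr => j _; apply: eq_bigr => l _; rewrite /a !mxE; congr (_ ^+ 2); ring.
  have -> : \sum_(i in B) sqnorm (v - x i) = \sum_l \sum_(i in B) a i l ^+ 2.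
    by rewrite [RHS]exchange_big.
  rewrite mulr_sumr; apply: ler_sum => l _.
  have -> : \sum_(i in B) \sum_(j in B) (a j l - a i l) ^+ 2 =
     2 * N * (\sum_(i in B) a i l ^+ 2) - 2 * (\sum_(i in B) a i l) ^+ 2.
    have E i : \sum_(j in B) (a j l - a i l) ^+ 2 =
       (\sum_(j in B) a j l ^+ 2 + N * a i l ^+ 2) - 2 * (\sum_(j in B) a j l) * a i l.
      have -> : N * a i l ^+ 2 = \sum_(j in B) a i l ^+ 2 by rewrite sumr_const mulr_natl.
      rewrite -mulrA mulr_suml mulr_sumr -big_split -sumrB.
      by apply: eq_bigr => j _ /=; ring.
    under eq_bigr do rewrite E.
    rewrite sumrB big_split /= -!mulr_sumr sumr_const -[_ *+ #|B|]mulr_natl -/N; ring.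
  by rewrite gerBl mulr_ge0// sqr_ge0.
have := le_trans sum_sep sum_ball.
have -> : 2 * N * (N * r) = N * (2 * N * r) by ring.
by rewrite ler_pM2l.
Qed.

End euclidean_packing.

(** * Impossibility for a fixed design *)

Section counting_probabilities.
Context d (T : measurableType d) (R : realType) (P : probability T R) (I : finType).
Context (A : I -> set T) (mA : forall i, measurable (A i)).
Local Open Scope ereal_scope.

Lemma sum_probabilityE :
  \sum_i P (A i) = \int[P]_w (\sum_i (\1_(A i) w : R))%:E.
Proof.
under [RHS]eq_integral do rewrite -sumEFin.
rewrite ge0_integral_sum//; last first.
  by move=> i; apply/measurable_EFinP; exact: measurable_indic.
by apply: eq_bigr => i _; rewrite integral_indic// setIT.
Qed.

Let measurable_count : measurable_fun setT (fun w => (\sum_i (\1_(A i) w : R))%:E).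
Proof.
apply/measurable_EFinP; apply: measurable_sum => i; exact: measurable_indic.
Qed.

Lemma sum_probability_le (c : R) : (0 <= c)%R ->
  (forall w, \sum_i (\1_(A i) w : R) <= c)%R -> \sum_i P (A i) <= c%:E.
Proof.
move=> c0 le_c; rewrite sum_probabilityE.
apply: (@le_trans _ _ (\int[P]_w c%:E)).
  apply: ge0_le_integral => //.
  by move=> w _; rewrite lee_fin sumr_ge0.
  by move=> w _; rewrite lee_fin.
by rewrite integral_cst// [X in _ * X]probability_setT mule1.
Qed.

(** Markov's inequality for the number of the events A i that occur; for c = 1 it is
    the union bound. *)
Lemma probability_le_sum (D : set T) (c : R) : measurable D -> (0 <= c)%R ->
  (forall w, D w -> c <= \sum_i (\1_(A i) w : R))%R -> c%:E * P D <= \sum_i P (A i).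
Proof.
move=> mD c0 le_c; rewrite sum_probabilityE -(setIT D) -integral_indic//.
rewrite -ge0_integralZl_EFin//; last first.
  by apply/measurable_EFinP; exact: measurable_indic.
apply: ge0_le_integral => //.
- by move=> w _; rewrite lee_fin mulr_ge0.
- by apply/measurable_EFinP; apply: measurable_funM => //; exact: measurable_indic.
move=> w _; rewrite lee_fin indicE; have [/set_mem Dw|_] := boolP (w \in D).
  by rewrite mulr1; exact: le_c.
by rewrite mulr0 sumr_ge0.
Qed.

End counting_probabilities.

Section fixed_design.
Context d (T : measurableType d) (R : realType) (P : probability T R) (k q n : nat).
Context (z : {RV P >-> 'cV[R]_n}) (sigma : R).
Hypothesis iidz : iid_normal_entries 0 sigma z.
Hypothesis sigma_gt0 : 0 < sigma.
Local Notation F := {ffun 'I_k -> 'I_q}.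
Context (e : 'I_k -> 'I_q -> 'cV[R]_n) (V D r theta tau s : R) (M : nat).

Let mean (J : F) : 'cV[R]_n := \sum_b e b (J b).

(** A success for J gives at least theta blocks b where J b is one of the M
    candidate values computed from y.  On each block the mean is moved back by
    e b (J b), at the cost e^tau plus the rare event, after which y carries no
    information on J b and M guesses among q values hit with probability M / q. *)
Lemma fixed_design_bound (v : 'cV[R]_n -> 'cV[R]_n) : measurable_fun setT v ->
  (0 < q)%N -> 0 <= s -> 0 <= theta <= k%:R -> 0 <= D ->
  (forall b j, sqnorm (e b j) <= V) ->
  (forall J J', D * (k%:R - (overlap J J')%:R) <= sqnorm (mean J - mean J')) ->
  (forall N : nat, (M < N)%N -> 2 * N%:R * r < (N%:R - 1) * (D * (k%:R - theta))) ->
  (theta%:E * \sum_J P [set w | (sqnorm (v (mean J + z w) - mean J) <= r)%R] <=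
   (k%:R * #|{: F}|%:R * (expR tau * (M%:R / q%:R) +
     expR (s * (1 + s) * (V / (2 * sigma ^+ 2)) - s * tau)))%:E)%E.
Proof.
move=> mv q0 s0 /andP[th0 thk] D0 eV sep packM.
pose A (y : 'cV[R]_n) := [set J : F | sqnorm (v y - mean J) <= r]%SET.
pose far (J J' : F) := (overlap J J')%:R < theta.
(* The candidate values are a function of the finite set A y alone, which makes the
   events below measurable. *)
have cover (A0 : {set F}) : {S : 'I_k -> {set 'I_q} | (forall b, (#|S b| <= M)%N) &
    forall y, A0 = A y -> forall J, J \in A0 -> theta <= #|[set b | J b \in S b]%SET|%:R}.
  have [/cid[y ->]|noy] := pselect (exists y, A0 = A y); last first.
    exists (fun=> finset.set0) => [b|y Ay]; first by rewrite cards0.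
    by exfalso; apply: noy; exists y.
  have farC : symmetric far by move=> J J'; rewrite /far overlapC.
  have [//|B BA farB|S SM hit] := @packing_cover k q far (A y) M.
    have [->|B0] := eqVneq B finset.set0; first by rewrite cards0.
    rewrite leqNgt; apply/negP => /packM; apply/negP; rewrite -leNgt.
    apply: (@ball_packing _ _ _ mean (v y)) => //.
      by move=> J /(fintype.subsetP BA) /[!inE].
    move=> J J' JB J'B JJ'; apply: le_trans (sep J J').
    by rewrite ler_wpM2l// lerB// ltW//; exact: farB.
  exists S => // y' _ J JA; have [J' [JJ' ov]] := hit J JA.
  apply: (@le_trans _ _ (overlap J J')%:R); last by rewrite ler_nat.
  case: JJ' => [<-|]; first by rewrite overlapJ.
  by rewrite /far -leNgt.
pose S A0 := let: exist2 U _ _ := cover A0 in U.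
have SM A0 b : (#|S A0 b| <= M)%N by rewrite /S; case: (cover A0).
have Shit y J : sqnorm (v y - mean J) <= r -> theta <= #|[set b | J b \in S (A y) b]%SET|%:R.
  rewrite /S; case: (cover (A y)) => S' _ hit rJ; apply: (hit y) => //.
  by rewrite inE.
have mA (y' : 'cV[R]_n) (J : F) : measurable [set y | J \in A (y + y')].
  rewrite (_ : [set y | _] = [set y | sqnorm (v (y + y') - mean J) <= r]); last first.
    by apply/seteqP; split => y /=; rewrite inE.
  apply: measurable_le_set => //.
  apply: measurable_fun_sqnorm; apply: measurable_fun_submx => //.
  by apply: measurableT_comp => //; exact: measurable_fun_addmx.
pose hit (J : F) b (y' : 'cV[R]_n) : set 'cV[R]_n := [set y | J b \in S (A (y + y')) b].
have mhit (J : F) b y' : measurable (hit J b y').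
  by apply: (measurable_preimage_finset (fun A0 => J b \in S A0 b)) => J'; exact: mA.
have mz : measurable_fun setT z by [].
have mhitz (J : F) b y' : measurable [set w | hit J b y' (z w)].
  by rewrite -[X in measurable X]setTI; exact: mz.
pose rest (J : F) b := \sum_(b' | b' != b) e b' (J b').
have restE (J : F) b : mean J = rest J b + e b (J b).
  by rewrite /mean (bigD1 b)//= addrC.
have rest_inv J b j : rest (set_coord J b j) b = rest J b.
  by apply: eq_bigr => b' /negbTE b'b; rewrite ffunE b'b.
have step1 (J : F) : (theta%:E * P [set w | (sqnorm (v (mean J + z w) - mean J) <= r)%R] <=
    \sum_b P [set w | hit J b (mean J) (z w)])%E.
  apply: probability_le_sum => // [|w /= rw].
    apply: measurable_le_set => //.
    apply: measurable_fun_sqnorm; apply: measurable_fun_submx => //.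
    by apply: measurableT_comp => //; exact: measurable_fun_addmx.
  apply: (le_trans (Shit _ _ rw)); rewrite -sum1dep_card natr_sum [leLHS]big_mkcond.
  apply: ler_sum => b _; rewrite indicE; case: ifPn => // Jb.
  by rewrite (_ : _ \in _ = true)//; apply/mem_set; rewrite /= /hit /= addrC.
have step2 (J : F) b : (P [set w | hit J b (mean J) (z w)] <=
    (expR tau)%:E * P [set w | hit J b (rest J b) (z w)] +
    (expR (s * (1 + s) * (V / (2 * sigma ^+ 2)) - s * tau))%:E)%E.
  apply: (@le_trans _ _ ((expR tau)%:E * P [set w | hit J b (rest J b) (z w)] +
    (expR (s * (1 + s) * (sqnorm (e b (J b)) / (2 * sigma ^+ 2)) - s * tau))%:E)%E).
    have := shift_probability_le iidz sigma_gt0 (e b (J b)) tau (mhit J b (rest J b)) s0.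
    rewrite (_ : [set w | hit J b (mean J) (z w)] =
      [set w | hit J b (rest J b) (z w + e b (J b))])//.
    by apply/seteqP; split => w; rewrite /hit /= (restE J b) -!addrA [e b _ + _]addrC.
  rewrite leeD2l// lee_fin ler_expR lerB// ler_wpM2l ?mulr_ge0 ?addr_ge0//.
  by rewrite ler_wpM2r// invr_ge0 mulr_ge0// sqr_ge0.
have step3 b : (\sum_J P [set w | hit J b (rest J b) (z w)] <=
    (M%:R * #|{: F}|%:R / q%:R)%:E)%E.
  apply: sum_probability_le => // w.
  rewrite ler_pdivlMr ?ltr0n// mulrC.
  rewrite (_ : \sum_J _ = #|[set J : F | J b \in S (A (z w + rest J b)) b]%SET|%:R).
    rewrite -!natrM ler_nat; apply: card_hit_coord => // J j.
    by rewrite rest_inv.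
  rewrite -sum1dep_card natr_sum [RHS]big_mkcond; apply: eq_bigr => J _.
  rewrite indicE; case: ifPn => Jh.
    by rewrite (_ : _ \in _ = true)//; apply/mem_set.
  by rewrite (_ : _ \in _ = false)//; apply/negbTE; rewrite notin_setE /= /hit /=; apply/negP.
set rho := expR (s * (1 + s) * (V / (2 * sigma ^+ 2)) - s * tau) in step2 *.
rewrite ge0_sume_distrr//.
apply: (@le_trans _ _ (\sum_(J : F) \sum_b ((expR tau)%:E *
    P [set w | hit J b (rest J b) (z w)] + rho%:E)%E)%E).
  apply: lee_sum => J _; apply: (le_trans (step1 J)).
  by apply: lee_sum => b _; exact: step2.
rewrite exchange_big /=.
apply: (@le_trans _ _ (\sum_(b : 'I_k) (expR tau * (M%:R * #|{: F}|%:R / q%:R) +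
    #|{: F}|%:R * rho)%:E)%E).
  apply: lee_sum => b _; rewrite big_split /= EFinD; apply: leeD.
    by rewrite -ge0_sume_distrr// EFinM lee_wpmul2l ?lee_fin ?expR_ge0.
  by rewrite sumEFin sumr_const mulr_natl.
rewrite sumEFin lee_fin sumr_const card_ord -mulr_natl.
by rewrite le_eqVlt; apply/orP; left; apply/eqP; ring.
Qed.

End fixed_design.

(** * The block prior and the random design *)

Section block_prior.
Context {R : realType} {k q p : nat} (col : 'I_k -> 'I_q -> 'I_p).
Hypothesis col_inj : forall b j b' j', col b j = col b' j' -> (b, j) = (b', j').
Local Notation F := {ffun 'I_k -> 'I_q}.

Definition block_signal (mu : R) (J : F) : 'cV[R]_p :=
  mu *: \sum_b delta_mx (col b (J b)) 0.

Lemma block_signalE mu (J : F) i :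
  block_signal mu J i 0 = mu * \sum_b (i == col b (J b))%:R.
Proof.
rewrite mxE summxE; congr (_ * _); apply: eq_bigr => b _.
by rewrite mxE eqxx andbT.
Qed.

Lemma l0norm_block_signal mu (J : F) : (l0norm (block_signal mu J) <= k)%N.
Proof.
rewrite -[leqRHS]card_ord -cardsT.
apply: (leq_trans _ (leq_imset_card (fun b => col b (J b)) _)).
apply: subset_leq_card; apply/fintype.subsetP => i; rewrite inE block_signalE.
apply: contraNT => iJ; rewrite big1 ?mulr0// => b _.
case: eqP => // ib; case/negP: iJ; rewrite ib; exact: imset_f.
Qed.

Lemma sqnorm_block_signalB mu (J J' : F) :
  sqnorm (block_signal mu J - block_signal mu J') =
  2 * mu ^+ 2 * (k%:R - (overlap J J')%:R).
Proof.
pose f (K : F) (i : 'I_p) : R := \sum_b (i == col b (K b))%:R.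
have dot (K K' : F) : \sum_i f K i * f K' i = (overlap K K')%:R.
  have -> : \sum_i f K i * f K' i = \sum_b f K' (col b (K b)).
    under eq_bigr do rewrite mulr_suml.
    rewrite exchange_big /=; apply: eq_bigr => b _.
    rewrite (bigD1 (col b (K b)))//= eqxx mul1r big1 ?addr0// => i /negbTE ->.
    by rewrite mul0r.
  rewrite /overlap -sum1dep_card natr_sum [RHS]big_mkcond; apply: eq_bigr => b _.
  rewrite /f (bigD1 b)//= big1 ?addr0; last first.
    move=> b' /negbTE b'b; case: eqP => // /col_inj[bb'].
    by rewrite bb' eqxx in b'b.
  case: (eqVneq (K b) (K' b)) => [->|KK']; first by rewrite eqxx.
  by case: eqP => // /col_inj[/eqP]; rewrite (negbTE KK').
have -> : sqnorm (block_signal mu J - block_signal mu J') =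
    \sum_i mu ^+ 2 * (f J i * f J i + f J' i * f J' i - 2 * (f J i * f J' i)).
  apply: eq_bigr => i _.
  have -> : (block_signal mu J - block_signal mu J') i 0 = mu * f J i - mu * f J' i.
    by rewrite mxE [in X in _ + X]mxE !block_signalE.
  by ring.
by rewrite -mulr_sumr sumrB big_split /= -mulr_sumr !dot !overlapJ; ring.
Qed.

Lemma mulmx_block_signal n (x : 'M[R]_(n, p)) mu (J : F) :
  x *m block_signal mu J = \sum_b mu *: (x *m delta_mx (col b (J b)) 0).
Proof. by rewrite -scalemxAr mulmx_sumr scaler_sumr. Qed.

End block_prior.

Section finite_sample.
Context d (T : measurableType d) (R : realType) (P : probability T R) (k q n p : nat).
Context (X : {RV P >-> 'M[R]_(n, p)}) (z : {RV P >-> 'cV[R]_n}) (sigma : R).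
Hypothesis iidX : iid_normal_entries 0 (Num.sqrt (1 / n%:R)) X.
Hypothesis iidz : iid_normal_entries 0 sigma z.
Hypothesis indepXz : independent_rv P X z.
Hypothesis sigma_gt0 : 0 < sigma.
Hypothesis n_gt0 : (0 < n)%N.
Hypothesis q_gt0 : (0 < q)%N.
Hypothesis kqp : (k * q <= p)%N.
Local Notation F := {ffun 'I_k -> 'I_q}.
Context (mu kap theta tau s r : R) (M : nat).
Hypothesis mu_gt0 : 0 < mu.
Hypothesis kap_gt0 : 0 < kap.
Hypothesis kap_le : kap <= 1 / 4.
Hypothesis s_ge0 : 0 <= s.
Hypothesis theta_gt0 : 0 < theta.
Hypothesis theta_le : theta <= k%:R.
Hypothesis packM : forall N : nat, (M < N)%N ->
  2 * N%:R * r < (N%:R - 1) * ((1 - 2 * kap) * (2 * mu ^+ 2) * (k%:R - theta)).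

Let kq_le : (#|{: 'I_k * 'I_q}| <= p)%N.
Proof. by rewrite card_prod !card_ord. Qed.

Let col (b : 'I_k) (j : 'I_q) : 'I_p := widen_ord kq_le (enum_rank (b, j)).

Let col_inj b j b' j' : col b j = col b' j' -> (b, j) = (b', j').
Proof. by move=> /(congr1 val)/= /val_inj/enum_rank_inj. Qed.

Let beta := block_signal col mu.
Let e b j : 'cV[R]_p := delta_mx (col b j) 0.

(* The designs for which the fixed-design bound applies: distances between signals
   are almost preserved from below, and no column is much longer than 1. *)
Let good (x : 'M[R]_(n, p)) : bool :=
  [forall J, forall J',
     (1 - 2 * kap) * sqnorm (beta J - beta J') <= sqnorm (x *m (beta J - beta J'))] &&
  [forall b, forall j, sqnorm (x *m e b j) <= 1 + 2 * kap].

Let measurable_good : measurable_fun setT good.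
Proof.
have mx (u : 'cV[R]_p) : measurable_fun setT (fun x : 'M[R]_(n, p) => sqnorm (x *m u)).
  by apply: measurable_fun_sqnorm; apply: measurable_fun_mulmx => //; exact: measurable_id.
have m_le (u : 'cV[R]_p) c : measurable [set x : 'M[R]_(n, p) | c <= sqnorm (x *m u)].
  exact: measurable_le_set.
have m_ge (u : 'cV[R]_p) c : measurable [set x : 'M[R]_(n, p) | sqnorm (x *m u) <= c].
  exact: measurable_le_set.
apply: (measurable_fun_bool true); rewrite setTI.
rewrite (_ : _ @^-1` _ =
  \bigcap_(JJ' in [set: F * F]) [set x | (1 - 2 * kap) * sqnorm (beta JJ'.1 - beta JJ'.2) <=
       sqnorm (x *m (beta JJ'.1 - beta JJ'.2))] `&`
  \bigcap_(bj in [set: 'I_k * 'I_q]) [set x | sqnorm (x *m e bj.1 bj.2) <= 1 + 2 * kap]).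
  by apply: measurableI; apply: fin_bigcap_measurable.
apply/seteqP; split => x /=.
  by move=> /andP[/forallP xF /forallP xe]; split => [[J J'] _|[b j] _];
    [exact: (forallP (xF J) J')|exact: (forallP (xe b) j)].
move=> [xF xe]; apply/andP; split; apply/forallP => a; apply/forallP => a'.
  exact: (xF (a, a')).
exact: (xe (a, a')).
Qed.

Let card_bad : R := #|{: (F * F) + ('I_k * 'I_q)}|%:R.

Let probability_bad :
  (P [set w | ~~ good (X w)] <= (card_bad * expR (- (n%:R * kap ^+ 2 / 4)))%:E)%E.
Proof.
pose tail (a : R) (u : 'cV[R]_p) : set T :=
  [set w | a * sqnorm (X w *m u) <= a * (1 - 2 * a) * sqnorm u].
pose bad (i : (F * F) + ('I_k * 'I_q)) : set T := match i with
  | inl JJ' => if JJ'.1 == JJ'.2 then set0 else tail kap (beta JJ'.1 - beta JJ'.2)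
  | inr bj => tail (- kap) (e bj.1 bj.2)
  end.
have mtail a u : measurable (tail a u).
  apply: measurable_le_set => //.
  apply: measurable_funM => //; apply: measurable_fun_sqnorm.
  by apply: measurable_fun_mulmx.
have mbad i : measurable (bad i).
  by case: i => [[J J']|[b j]] /=; [case: ifP => // _|]; exact: mtail.
have mgoodX : measurable [set w | ~~ good (X w)].
  have := measurableT_comp measurable_good (measurable_funPT X).
  move=> /(_ measurableT [set false]); rewrite setTI => mg.
  rewrite (_ : [set w | _] = (good \o X) @^-1` [set false])//; first exact: mg.
  by apply/seteqP; split => w /=; [move/negbTE|move=> ->].
rewrite -[leLHS]mul1e.
apply: (@le_trans _ _ (\sum_i P (bad i))%E).
  apply: probability_le_sum => // w /=; rewrite negb_and => badw.
  suff [i iw] : exists i, bad i w.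
    rewrite (bigD1 i)//= indicE mem_set// lerDl; apply: sumr_ge0 => j _.
    by rewrite indicE.
  case/orP: badw => /forallPn[a /forallPn[a']]; rewrite -ltNge => lt_a.
    exists (inl (a, a')) => /=; case: eqP => [aa'|_].
      by move: lt_a; rewrite aa' subrr mulmx0 /sqnorm !big1 ?mulr0 ?ltxx// => i _; rewrite mxE expr0n.
    by rewrite /tail /= -mulrA ler_pM2l// ltW.
  exists (inr (a, a')) => /=; rewrite /tail /= sqnorm_delta mulr1 !mulNr lerN2.
  by rewrite ler_pM2l// mulrN opprK ltW.
rewrite /card_bad; apply: (@le_trans _ _
    (\sum_(i : (F * F) + ('I_k * 'I_q)) (expR (- (n%:R * kap ^+ 2 / 4)))%:E)%E).
  apply: lee_sum => -[[J J']|[b j]] _ /=.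
    case: eqP => [_|/eqP JJ']; first by rewrite measure0 lee_fin expR_ge0.
    apply: sqnorm_mulmx_tail => //; last by rewrite gtr0_norm.
    rewrite sqnorm_block_signalB//.
    rewrite !mulr_gt0 ?exprn_gt0// subr_gt0 ltr_nat ltn_neqAle.
    rewrite /overlap -[leqRHS]card_ord max_card andbT.
    apply: contra JJ' => /eqP ov; apply/eqP/ffunP => b.
    have : [set b | J b == J' b]%SET = finset.setT.
      by apply/eqP; rewrite eqEcard finset.subsetT cardsT ov card_ord leqnn.
    by move=> /finset.setP/(_ b); rewrite !inE => /eqP.
  rewrite -[kap ^+ 2]sqrrN; apply: sqnorm_mulmx_tail => //.
    by rewrite sqnorm_delta.
  by rewrite normrN gtr0_norm.
by rewrite sumEFin sumr_const [#|_|%:R * _]mulr_natl.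
Qed.

Let rho : R := k%:R * (expR tau * (M%:R / q%:R) +
     expR (s * (1 + s) * (mu ^+ 2 * (1 + 2 * kap) / (2 * sigma ^+ 2)) - s * tau)).

(** By independence the noise may be integrated first, with the design frozen.  On a
    good design the fixed-design bound holds for the average over J, and some J is
    at most the average. *)
Lemma finite_sample_lower_bound (bhat : estimator R n p) :
  exists2 beta : 'cV[R]_p, (l0norm beta <= k)%N &
    (P [set w | (prediction_loss X z bhat beta w <= r)%R] <=
     (card_bad * expR (- (n%:R * kap ^+ 2 / 4)) + rho / theta)%:E)%E.
Proof.
pose f (J : F) (xy : 'M[R]_(n, p) * 'cV[R]_n) : bool := good xy.1 &&
  (sqnorm (xy.1 *m bhat (xy.1, xy.1 *m beta J + xy.2) - xy.1 *m beta J) <= r).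
have ffun0 : (0 < #|{: F}|)%N.
  by apply/card_gt0P; exists [ffun=> Ordinal q_gt0].
have rho_ge0 : 0 <= rho.
  by rewrite mulr_ge0 ?addr_ge0 ?mulr_ge0 ?expR_ge0 ?divr_ge0.
have mloss J : measurable_fun setT (fun xy : 'M[R]_(n, p) * 'cV[R]_n =>
    sqnorm (xy.1 *m bhat (xy.1, xy.1 *m beta J + xy.2) - xy.1 *m beta J)).
  have mxb : measurable_fun setT (fun xy : 'M[R]_(n, p) * 'cV[R]_n => xy.1 *m beta J).
    exact: measurable_fun_mulmx.
  apply: measurable_fun_sqnorm; apply: measurable_fun_submx => //.
  apply: measurable_fun_mulmx => //; apply: measurableT_comp => //.
  by apply: measurable_fun_pair => //; exact: measurable_fun_addmx.
have mf J : measurable_fun setT (f J).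
  apply: measurable_and; first exact: measurableT_comp.
  exact: measurable_fun_ler.
have mX : measurable_fun setT X by [].
have mz : measurable_fun setT z by [].
have mXz : measurable_fun setT (fun w => (X w, z w)) by exact: measurable_fun_pair.
have mset (g : T -> bool) : measurable_fun setT g -> measurable [set w | g w].
  move=> mg; rewrite (_ : [set w | g w] = g @^-1` [set true])//.
  by rewrite -[X in measurable X]setTI; exact: mg.
pose E J := [set w | f J (X w, z w)].
have mE J : measurable (E J) by apply: mset; exact: measurableT_comp.
pose G (xy : 'M[R]_(n, p) * 'cV[R]_n) : \bar R := (\sum_J (f J xy)%:R)%:E.
have mG : measurable_fun setT G.
  apply/measurable_EFinP; apply: measurable_sum => J.
  rewrite (_ : (fun xy => _) = fun xy => if f J xy then 1 else 0).
    exact: measurable_fun_ifT.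
  by apply/funext => xy; case: (f J xy).
have G0 xy : (0 <= G xy)%E by rewrite lee_fin sumr_ge0.
have sumE : (\sum_J P (E J) <= (#|{: F}|%:R * (rho / theta))%:E)%E.
  rewrite sum_probabilityE//.
  have -> : (\int[P]_w (\sum_J (\1_(E J) w : R))%:E = \int[P]_w G (X w, z w))%E.
    apply: eq_integral => w _; congr _%:E; apply: eq_bigr => J _.
    by rewrite indicE; congr ((nat_of_bool _)%:R); apply/idP/idP; rewrite inE.
  rewrite (independent_integral mX mz indepXz mG G0).
  apply: (@le_trans _ _ (\int[P]_w (#|{: F}|%:R * (rho / theta))%:E)%E); last first.
    by rewrite integral_cst// [X in (_ * X)%E]probability_setT mule1.
  have mG' : measurable_fun setT (fun ww : T * T => G (X ww.1, z ww.2)).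
    apply: measurableT_comp => //; apply: measurable_fun_pair; exact: measurableT_comp.
  apply: ge0_le_integral => //.
  - by move=> w _; exact: integral_ge0.
  - exact: (measurable_fun_fubini_tonelli_F (m2 := P) _ mG' (fun=> G0 _)).
  - move=> w _; have [gX|/negbTE bX] := boolP (good (X w)); last first.
      rewrite (_ : (fun w' => _) = cst 0%E); last first.
        by apply/funext => w'; rewrite /G /f /= bX /= big1.
      by rewrite integral_cst// mul0e lee_fin mulr_ge0// divr_ge0// ltW.
    pose v y := X w *m bhat (X w, y).
    pose hitJ J := [set w' | sqnorm (v (X w *m beta J + z w') - X w *m beta J) <= r].
    have mv : measurable_fun setT v.
      have mpair : measurable_fun setT (fun y : 'cV[R]_n => (X w, y)).
        by apply: measurable_fun_pair => //; exact: measurable_id.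
      by apply: measurable_fun_mulmx => //; exact: (measurableT_comp (measurable_funPT bhat) mpair).
    have mhitJ J : measurable (hitJ J).
      apply: measurable_le_set => //.
      apply: measurable_fun_sqnorm; apply: measurable_fun_submx => //.
      by apply: measurableT_comp => //; exact: measurable_fun_addmx.
    have -> : (\int[P]_w' G (X w, z w') = \sum_J P (hitJ J))%E.
      rewrite sum_probabilityE//; apply: eq_integral => w' _; congr _%:E.
      apply: eq_bigr => J _; rewrite /f /= gX /= indicE; congr ((nat_of_bool _)%:R).
      by apply/idP/idP; rewrite inE.
    move: gX => /andP[/forallP isoX /forallP colX].
    have meanE J : X w *m beta J = \sum_b mu *: (X w *m e b (J b)).
      exact: mulmx_block_signal.
    have meanE' : (fun J => X w *m beta J) = (fun J : F => \sum_b mu *: (X w *m e b (J b))).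
      by apply/funext => J; exact: meanE.
    have V_le b j : sqnorm (mu *: (X w *m e b j)) <= mu ^+ 2 * (1 + 2 * kap).
      by rewrite sqnormZ ler_wpM2l ?sqr_ge0//; exact: (forallP (colX b) j).
    have D_ge0 : 0 <= (1 - 2 * kap) * (2 * mu ^+ 2).
      apply: mulr_ge0; last by rewrite mulr_ge0// sqr_ge0.
      by have := kap_le; lra.
    have sep J J' : (1 - 2 * kap) * (2 * mu ^+ 2) * (k%:R - (overlap J J')%:R) <=
        sqnorm ((\sum_b mu *: (X w *m e b (J b))) - (\sum_b mu *: (X w *m e b (J' b)))).
      rewrite -!meanE -mulmxBr -mulrA -(sqnorm_block_signalB col_inj).
      exact: (forallP (isoX J) J').
    have theta_int : 0 <= theta <= k%:R by rewrite theta_le ltW.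
    have := fixed_design_bound iidz sigma_gt0 tau mv q_gt0 s_ge0 theta_int D_ge0 V_le sep packM.
    have -> : k%:R * #|{: F}|%:R * (expR tau * (M%:R / q%:R) + expR (s * (1 + s) *
        (mu ^+ 2 * (1 + 2 * kap) / (2 * sigma ^+ 2)) - s * tau)) =
        theta * (#|{: F}|%:R * (rho / theta)).
      rewrite [RHS]mulrCA [theta * _]mulrC divfK ?gt_eqF//.
      by rewrite /rho [RHS]mulrCA [RHS]mulrA.
    rewrite EFinM lee_pmul2l ?lte_fin//; apply: le_trans.
    by apply: lee_sum => J _; rewrite /hitJ meanE.
have [J0 _ minJ] : exists2 J0 : F, true & forall J, (P (E J0) <= P (E J))%E.
  pose J0 := [arg min_(J < [ffun=> Ordinal q_gt0]) P (E J)]%O.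
  exists J0 => // J; rewrite /J0; case: Order.TotalTheory.arg_minP => // J1 _ minJ1.
  exact: minJ1.
have PJ0 : (P (E J0) <= (rho / theta)%:E)%E.
  have : (#|{: F}|%:R%:E * P (E J0) <= (#|{: F}|%:R * (rho / theta))%:E)%E.
    apply: le_trans sumE; rewrite -[leLHS]/(_%:E * _)%E.
    apply: (@le_trans _ _ (\sum_(J : F) P (E J0))%E); last by apply: lee_sum => J _.
    have PE : P (E J0) = (fine (P (E J0)))%:E by rewrite fineK// fin_num_measure.
    by rewrite PE sumEFin sumr_const -EFinM mulr_natl.
  by rewrite EFinM lee_pmul2l// ?lte_fin ?ltr0n.
exists (beta J0); first exact: l0norm_block_signal.
have mgoodX : measurable [set w | ~~ good (X w)].
  by apply: (mset (fun w => ~~ good (X w))); apply: measurable_neg; exact: measurableT_comp.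
apply: (@le_trans _ _ (P ([set w | ~~ good (X w)] `|` E J0))).
  apply: le_measure; rewrite ?inE.
  - rewrite (_ : [set w | _] = [set w | sqnorm (X w *m bhat (X w, X w *m beta J0 + z w)
       - X w *m beta J0) <= r]).
      apply: measurable_le_set => //.
      exact: (measurableT_comp (mloss J0) mXz).
    by apply/seteqP; split => w; rewrite /= /prediction_loss l2norm_sqr.
  - exact: measurableU.
  move=> w; rewrite /= /prediction_loss l2norm_sqr /E /f /= => loss_le.
  by case: (good (X w)); [right|left].
apply: (le_trans (measureU2 _ _ _)) => //.
by rewrite EFinD leeD.
Qed.

End finite_sample.

(** * Minimax probability and choice of the constants *)

Section minimax_bounds.
Context d (T : measurableType d) (R : realType) (P : probability T R) (k n p : nat).
Context (X : {RV P >-> 'M[R]_(n, p)}) (z : {RV P >-> 'cV[R]_n}) (sigma : R).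

Lemma measurable_prediction_loss (bhat : estimator R n p) beta :
  measurable_fun setT (prediction_loss X z bhat beta).
Proof.
have mX : measurable_fun setT X by [].
have mz : measurable_fun setT z by [].
rewrite (_ : prediction_loss X z bhat beta =
  fun w => sqnorm (X w *m bhat (X w, response X z beta w) - X w *m beta)); last first.
  by apply/funext => w; rewrite /prediction_loss l2norm_sqr.
have mXb : measurable_fun setT (fun w => X w *m beta).
  exact: measurable_fun_mulmx.
apply: measurable_fun_sqnorm; apply: measurable_fun_submx => //.
apply: measurable_fun_mulmx => //; apply: measurableT_comp => //.
by apply: measurable_fun_pair => //; exact: measurable_fun_addmx.
Qed.

Let ratio_gt (bhat : estimator R n p) eps beta :=
  [set w | prediction_loss X z bhat beta w /
     (2 * sigma ^+ 2 * k%:R * ln (p%:R / k%:R)) > 1 - eps].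

Let measurable_ratio_gt bhat eps beta : measurable (ratio_gt bhat eps beta).
Proof.
rewrite (_ : ratio_gt bhat eps beta = ~` [set w | prediction_loss X z bhat beta w /
     (2 * sigma ^+ 2 * k%:R * ln (p%:R / k%:R)) <= 1 - eps]).
  apply: measurableC; apply: measurable_le_set => //.
  by apply: measurable_funM => //; exact: measurable_prediction_loss.
by apply/seteqP; split => w /=; rewrite /ratio_gt /= ltNge => /negP.
Qed.

Lemma minimax_prob_le1 eps : (minimax_prob X z sigma k eps <= 1)%E.
Proof.
pose bhat : estimator R n p := cst 0.
apply: (@le_trans _ _ (ereal_sup [set P (ratio_gt bhat eps beta)
    | beta in [set b : 'cV[R]_p | (l0norm b <= k)%N]])).
  by apply: ereal_inf_lbound; exists bhat.
by apply: ge_ereal_sup => _ [beta _ <-]; exact: probability_le1.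
Qed.

Lemma minimax_prob_ge eps delta :
  (forall bhat : estimator R n p, exists2 beta : 'cV[R]_p, (l0norm beta <= k)%N &
    (P [set w | (prediction_loss X z bhat beta w <=
       (1 - eps) * (2 * sigma ^+ 2 * k%:R * ln (p%:R / k%:R)))%R] <= delta%:E)%E) ->
  0 < 2 * sigma ^+ 2 * k%:R * ln (p%:R / k%:R) ->
  forall eps', eps <= eps' -> ((1 - delta)%:E <= minimax_prob X z sigma k eps')%E.
Proof.
move=> bad pos eps' le_eps.
apply: le_ereal_inf_tmp => _ [bhat _ <-].
have [beta beta_k Pbeta] := bad bhat.
apply: (@le_trans _ _ (P (ratio_gt bhat eps' beta))); last first.
  by apply: ereal_sup_ubound; exists beta.
set B := [set w | _] in Pbeta.
have mB : measurable B.
  apply: measurable_le_set => //.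
  exact: measurable_prediction_loss.
apply: (@le_trans _ _ (P (~` B))).
  rewrite probability_setC// EFinB; apply: leeB => //.
apply: le_measure; rewrite ?inE//; first exact: measurableC.
move=> w /= /negP; rewrite -ltNge => lt_loss.
rewrite /ratio_gt /= ltr_pdivlMr//; apply: le_lt_trans lt_loss.
by rewrite ler_pM2r// lerD2l lerN2.
Qed.

End minimax_bounds.

Section numeric_choice.
Context d (T : measurableType d) (R : realType) (P : probability T R) (k n p : nat).
Context (X : {RV P >-> 'M[R]_(n, p)}) (z : {RV P >-> 'cV[R]_n}) (sigma : R).

(** With eps = 8 del, the constants of the finite-sample bound are kap = del / 2,
    theta = del k, mu^2 = 2 sigma^2 (1 - del) ln q, tau = (1 - del^2 / 2) ln q and
    s = del^2 / 4, so that |mu X_j|^2 / (2 sigma^2) <= (1 - del^2) ln q < tau < ln q.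
    The losses del in mu^2, in the isometry, in the overlap and in replacing
    ln (p/k) by ln q amount to less than 8 del altogether, which leaves the packing
    inequality true for N > 1 / del. *)
Lemma minimax_prob_lower_bound (del : R) (M : nat) :
  iid_normal_entries 0 (Num.sqrt (1 / n%:R)) X -> iid_normal_entries 0 sigma z ->
  independent_rv P X z -> 0 < sigma -> (0 < n)%N -> (0 < k)%N -> (0 < p)%N ->
  0 < del <= 1 / 16 -> del^-1 <= M%:R -> 2 / del <= ln (p%:R / k%:R) ->
  forall eps', 8 * del <= eps' ->
  ((1 - (2 * expR (2 * (k%:R * ln (p%:R / k%:R)) - n%:R * (del / 2) ^+ 2 / 4) +
    (M%:R + 1) / del * expR (- (del ^+ 4 / 32 * ln (p%:R / k%:R)))))%:E <=
   minimax_prob X z sigma k eps')%E.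
Proof.
move=> iidX iidz indepXz sigma0 n0 k0 p0 /andP[del0 del1] delM.
set x : R := p%:R / k%:R; set Lam := ln x => Lam_ge.
have kR : 0 < k%:R :> R by rewrite ltr0n.
have pR : 0 < p%:R :> R by rewrite ltr0n.
have x0 : 0 < x by rewrite divr_gt0.
have two_del : 32 <= 2 / del by rewrite ler_pdivlMr//; lra.
have Lam_lt : Lam < x by exact: ln_sublinear.
pose q := (p %/ k)%N.
have qx : q%:R <= x by rewrite ler_pdivlMr// -natrM ler_nat leq_trunc_div.
have xq : x < q%:R + 1.
  by rewrite ltr_pdivrMr// natr1 -natrM ltr_nat; exact: ltn_ceil.
have q2 : (1 < q)%N by rewrite -(ltr_nat R); lra.
have q0 : (0 < q)%N by exact: ltn_trans q2.
have qR : 0 < q%:R :> R by rewrite ltr0n.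
set lam : R := ln q%:R.
have lam_le : lam <= Lam by rewrite ler_ln ?posrE.
have lam_ge : Lam - 1 <= lam.
  have half : x / 2 <= q%:R by rewrite ler_pdivrMr//; lra.
  have ln2 : ln (2 : R) <= 1 by have := @le_ln1Dx R 1; apply; lra.
  have : ln (x / 2) <= lam by rewrite ler_ln ?posrE// divr_gt0.
  rewrite lnM ?posrE ?invr_gt0// lnV ?posrE//; rewrite -/Lam; lra.
have lam0 : 0 < lam by lra.
have Lam_lam : Lam <= (1 + del) * lam.
  have : 2 <= del * Lam by rewrite mulrC -ler_pdivrMr.
  have : del * (Lam - 1) <= del * lam by rewrite ler_pM2l.
  lra.
have q_exp : expR lam = q%:R by rewrite /lam lnK ?posrE.
pose mu := Num.sqrt (2 * sigma ^+ 2 * (1 - del) * lam).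
have mu2_gt0 : 0 < 2 * sigma ^+ 2 * (1 - del) * lam.
  by rewrite !mulr_gt0 ?exprn_gt0//; lra.
have mu0 : 0 < mu by rewrite sqrtr_gt0.
have mu2 : mu ^+ 2 = 2 * sigma ^+ 2 * (1 - del) * lam by rewrite sqr_sqrtr// ltW.
pose r := (1 - 8 * del) * (2 * sigma ^+ 2 * k%:R * Lam).
have kap0 : 0 < del / 2 by lra.
have kap1 : del / 2 <= 1 / 4 by lra.
have th0 : 0 < del * k%:R by rewrite mulr_gt0.
have th1 : del * k%:R <= k%:R by rewrite ler_piMl//; lra.
have s0 : 0 <= del ^+ 2 / 4 by rewrite divr_ge0// sqr_ge0.
have packM (N : nat) : (M < N)%N -> 2 * N%:R * r <
    (N%:R - 1) * ((1 - 2 * (del / 2)) * (2 * mu ^+ 2) * (k%:R - del * k%:R)).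
  rewrite -(ltr_nat R) => MN.
  have N_del : 1 < del * N%:R.
    by rewrite mulrC -ltr_pdivrMr// mul1r; apply: le_lt_trans MN.
  have c0 : 0 < 4 * sigma ^+ 2 * k%:R * lam by rewrite !mulr_gt0 ?exprn_gt0.
  have -> : (N%:R - 1) * ((1 - 2 * (del / 2)) * (2 * mu ^+ 2) * (k%:R - del * k%:R)) =
      4 * sigma ^+ 2 * k%:R * lam * ((N%:R - 1) * (1 - del) ^+ 3).
    by rewrite mu2; field.
  apply: (@le_lt_trans _ _ (4 * sigma ^+ 2 * k%:R * lam * (N%:R * ((1 - 8 * del) * (1 + del))))).
    have -> : 2 * N%:R * r = 4 * sigma ^+ 2 * k%:R * N%:R * (1 - 8 * del) * Lam.
      by rewrite /r; ring.
    have -> : 4 * sigma ^+ 2 * k%:R * lam * (N%:R * ((1 - 8 * del) * (1 + del))) =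
       4 * sigma ^+ 2 * k%:R * N%:R * (1 - 8 * del) * ((1 + del) * lam) by ring.
    by rewrite ler_wpM2l// !mulr_ge0// ?sqr_ge0 ?ltW//; lra.
  rewrite ltr_pM2l//.
  apply: (@le_lt_trans _ _ (N%:R * (1 - 7 * del))).
    rewrite ler_wpM2l//; have : 0 <= del ^+ 2 by exact: sqr_ge0.
    rewrite expr2; lra.
  apply: (@lt_le_trans _ _ ((N%:R - 1) * (1 - 3 * del))); first by lra.
  rewrite ler_wpM2l//; first by rewrite subr_ge0 ler1n (leq_ltn_trans _ (_ : M < N)%N)// -(ltr_nat R).
  have -> : (1 - del) ^+ 3 = 1 - 3 * del + del ^+ 2 * (3 - del) by ring.
  by rewrite lerDl mulr_ge0 ?sqr_ge0//; lra.
have kqp : (k * q <= p)%N by rewrite mulnC leq_trunc_div.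
have pos : 0 < 2 * sigma ^+ 2 * k%:R * Lam by rewrite !mulr_gt0 ?exprn_gt0//; lra.
apply: minimax_prob_ge => // bhat.
have [beta beta_k Pbeta] := finite_sample_lower_bound iidX iidz indepXz sigma0 n0 q0 kqp
  ((1 - del ^+ 2 / 2) * lam) mu0 kap0 kap1 s0 th0 th1 packM bhat.
exists beta => //; apply: (le_trans Pbeta); rewrite lee_fin.
apply: lerD.
  apply: (@le_trans _ _ (2 * expR (2 * (k%:R * lam)) *
     expR (- (n%:R * (del / 2) ^+ 2 / 4)))).
    rewrite ler_pM2r ?expR_gt0//.
    have -> : expR (2 * (k%:R * lam)) = (q ^ k * q ^ k)%:R.
      by rewrite expRM_natl mulrC expRM_natr q_exp -natrX expr2 natrM natrX.
    rewrite card_sum !card_prod card_ffun !card_ord -[X in X * _]/(2%:R) -natrM ler_nat.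
    rewrite mul2n -addnn leq_add2l leq_mul//; first exact/ltnW/ltn_expl.
    by rewrite -[X in (X <= _)%N]expn1 leq_pexp2l.
  rewrite -mulrA -expRD ler_pM2l// ler_expR lerD2r.
  by rewrite ler_pM2l// ler_pM2l.
have -> : del ^+ 2 / 4 * (1 + del ^+ 2 / 4) * (mu ^+ 2 * (1 + 2 * (del / 2)) / (2 * sigma ^+ 2)) -
    del ^+ 2 / 4 * ((1 - del ^+ 2 / 2) * lam) =
    - (del ^+ 2 / 4 * lam) * (del ^+ 2 / 4 + del ^+ 4 / 4).
  by rewrite mu2; field; rewrite gt_eqF.
set E := expR (- (del ^+ 4 / 32 * Lam)).
have d2 : 0 <= del ^+ 2 by exact: sqr_ge0.
have d4 : 0 <= del ^+ 4 by rewrite exprn_ge0// ltW.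
have d4E : del ^+ 4 = del ^+ 2 * del ^+ 2 by rewrite -exprD.
have Lam2 : Lam <= 2 * lam by lra.
have E1 : expR ((1 - del ^+ 2 / 2) * lam) * (M%:R / q%:R) <= M%:R * E.
  rewrite mulrCA ler_wpM2l// -q_exp -expRN -expRD ler_expR.
  have : 0 <= del ^+ 4 * (2 * lam - Lam) by rewrite mulr_ge0// subr_ge0.
  have d2_le1 : 0 <= 1 - del ^+ 2 by rewrite subr_ge0 expr2; nra.
  have : 0 <= del ^+ 2 * lam * (1 - del ^+ 2).
    by rewrite mulr_ge0// mulr_ge0// ltW.
  have : 0 <= del ^+ 2 * lam by rewrite mulr_ge0// ltW.
  rewrite d4E; lra.
have E2 : expR (- (del ^+ 2 / 4 * lam) * (del ^+ 2 / 4 + del ^+ 4 / 4)) <= E.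
  rewrite ler_expR mulNr lerN2.
  have : 0 <= del ^+ 4 * (2 * lam - Lam) by rewrite mulr_ge0// subr_ge0.
  have : 0 <= del ^+ 2 * lam * del ^+ 4 by rewrite mulr_ge0// mulr_ge0// ltW.
  rewrite d4E; lra.
have -> : (M%:R + 1) / del * E = (M%:R * E + E) / del by field; rewrite gt_eqF.
have -> : del * k%:R = k%:R * del by rewrite mulrC.
rewrite invfM mulrA; rewrite [k%:R * _]mulrC mulrK ?unitfE ?gt_eqF//.
by rewrite ler_pM2r ?invr_gt0// lerD.
Qed.

End numeric_choice.

(** * Asymptotics *)

Section main_asymptotics.
Context {R : realType}.

Lemma cvg_expR_oppM (c : R) (u : R^nat) : 0 < c -> u @ \oo --> +oo ->
  (fun m => expR (- (c * u m))) @ \oo --> (0 : R).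
Proof.
move=> c0 u_infty; apply: (cvg_comp (fun m => c * u m) (fun x => expR (- x))); last first.
  exact: cvgr_expR.
apply/cvgryPge => A; move/cvgryPge: u_infty => /(_ (A / c)).
by apply: filterS => m; rewrite ler_pdivrMr// mulrC.
Qed.

(** With t = k/p this is t ln (1/t) <= 2 sqrt t, which follows from ln x < x at
    x = 1 / sqrt t.  It shows that k ln (p/k) = o(p). *)
Lemma mul_ln_ratio_le (k p : nat) (a : R) : (0 < k)%N -> (0 < p)%N -> 0 < a ->
  k%:R / p%:R <= a ^+ 2 -> k%:R * ln (p%:R / k%:R) <= 2 * a * p%:R.
Proof.
move=> k0 p0 a0; have kR : 0 < k%:R :> R by rewrite ltr0n.
have pR : 0 < p%:R :> R by rewrite ltr0n.
set t := k%:R / p%:R => ta.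
have t0 : 0 < t by rewrite divr_gt0.
have st0 : 0 < Num.sqrt t by rewrite sqrtr_gt0.
have st : Num.sqrt t <= a.
  by rewrite -(ger0_norm (ltW a0)) -sqrtr_sqr ler_wsqrtr.
have -> : p%:R / k%:R = (Num.sqrt t)^-1 ^+ 2 :> R.
  by rewrite exprVn sqr_sqrtr ?ltW// invfM invrK mulrC.
rewrite lnXn ?invr_gt0// mulr2n.
have ln_le : ln (Num.sqrt t)^-1 <= (Num.sqrt t)^-1.
  by rewrite ltW// ln_sublinear// invr_gt0.
have -> : k%:R = Num.sqrt t * Num.sqrt t * p%:R.
  by rewrite -expr2 sqr_sqrtr ?ltW// divfK// gt_eqF.
have : Num.sqrt t * ln (Num.sqrt t)^-1 <= 1.
  by rewrite mulrC -ler_pdivlMr// mul1r.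
set l := ln _ => stl.
have -> : Num.sqrt t * Num.sqrt t * p%:R * (l + l) = 2 * (Num.sqrt t * p%:R) * (Num.sqrt t * l).
  by ring.
apply: (@le_trans _ _ (2 * (Num.sqrt t * p%:R))).
  by rewrite ler_piMr// !mulr_ge0// ltW.
by rewrite mulrA ler_pM2r// ler_pM2l.
Qed.

End main_asymptotics.

Unset Implicit Arguments.
Theorem corollary1p5 (R : realType) (sigma : R) (hsigma : 0 < sigma)
    (k n p : nat -> nat)
    (hk : forall m, (0 < k m)%N)
    (hn : forall m, (0 < n m)%N)
    (hp : forall m, (0 < p m)%N)
    (p_infty : p @ \oo --> \oo)
    (kp_0 : (fun m => (k m)%:R / (p m)%:R : R) @ \oo --> (0 : R))
    (p_O_n : (fun m => (p m)%:R : R) =O_\oo (fun m => (n m)%:R : R))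
    (d : nat -> measure_display)
    (Omega : forall m, measurableType (d m))
    (P : forall m, probability (Omega m) R)
    (X : forall m, {RV (P m) >-> 'M[R]_(n m, p m)})
    (z : forall m, {RV (P m) >-> 'cV[R]_(n m)})
    (X_iid : forall m, iid_normal_entries 0 (Num.sqrt (1 / (n m)%:R)) (X m))
    (z_normal : forall m, iid_normal_entries 0 sigma (z m))
    (Xz_indep : forall m, independent_rv (P m) (X m) (z m))
    (eps : R) (heps : 0 < eps) :
  (fun m => minimax_prob (X m) (z m) sigma (k m) eps) @ \oo --> 1%E.
Proof.
pose del := Num.min eps (1 / 2) / 8.
have del0 : 0 < del by rewrite divr_gt0// lt_min heps /=; lra.
have del_int : 0 < del <= 1 / 16.
  rewrite del0 /= ler_pdivrMr//; have : Num.min eps (1 / 2) <= 1 / 2 by rewrite ge_min lexx orbT.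
  lra.
have del_eps : 8 * del <= eps by rewrite mulrC divfK// ge_min lexx.
pose M := Num.bound del^-1.
have delM : del^-1 <= M%:R by rewrite ltW// archi_boundP// invr_ge0 ltW.
pose Lam m : R := ln ((p m)%:R / (k m)%:R).
have kR m : 0 < (k m)%:R :> R by rewrite ltr0n.
have pR m : 0 < (p m)%:R :> R by rewrite ltr0n.
have small_ratio c : 0 < c -> \forall m \near \oo, (k m)%:R / (p m)%:R <= c :> R.
  move=> c0; have /cvgr_lt/(_ c c0) := kp_0.
  by apply: filterS => m /ltW.
have Lam_infty : Lam @ \oo --> +oo.
  apply/cvgryPge => A; have := small_ratio (expR (- A)) (expR_gt0 _).
  apply: filterS => m le_ratio.
  rewrite /Lam -[X in ln X]invrK lnV ?posrE ?invr_gt0 ?divr_gt0// invf_div.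
  rewrite lerNr -[leRHS]expRK ler_ln ?posrE ?divr_gt0 ?expR_gt0//.
have [C C0 pCn] : exists2 C : R, 0 < C & \forall m \near \oo, (p m)%:R <= C * (n m)%:R.
  move/eqO_exP: p_O_n => [C C0 pCn]; exists C => //.
  by apply: filterS pCn => m; rewrite !ger0_norm.
have p_inftyR : (fun m => (p m)%:R : R) @ \oo --> +oo.
  apply/cvgryPge => A; move/cvgnyPge: p_infty => /(_ (Num.bound `|A|)).
  apply: filterS => m; rewrite -(ler_nat R); apply: le_trans.
  by rewrite (le_trans (ler_norm _))// ltW// archi_boundP.
pose c := (del / 2) ^+ 2 / 8.
have c0 : 0 < c by rewrite divr_gt0// exprn_gt0// divr_gt0.
pose err m : R := 2 * expR (- (c / C * (p m)%:R)) +
  (M%:R + 1) / del * expR (- (del ^+ 4 / 32 * Lam m)).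
have err0 : err @ \oo --> (0 : R).
  rewrite -[X in _ --> X]addr0; apply: cvgD.
    rewrite -[X in _ --> X](mulr0 2); apply: cvgMr; apply: cvg_expR_oppM => //.
    exact: divr_gt0.
  rewrite -[X in _ --> X](mulr0 ((M%:R + 1) / del)); apply: cvgMr.
  by apply: cvg_expR_oppM => //; rewrite divr_gt0// exprn_gt0.
apply: (@squeeze_cvge _ _ _ _ (fun m => (1 - err m)%:E) _ (cst 1%E)); last 2 first.
- apply: cvg_EFin; first exact: nearW.
  rewrite (_ : fine \o _ = fun m => 1 - err m)// -[X in _ --> X]subr0.
  by apply: cvgB => //; exact: cvg_cst.
- exact: cvg_cst.
(* The threshold a^2 for k/p makes 2 k ln (p/k) at most c n, half of the exponent
   2 c n of the design event. *)
pose a := c / (4 * C).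
have a0 : 0 < a by rewrite divr_gt0// mulr_gt0.
have := small_ratio _ (exprn_gt0 2 a0); move/cvgryPge: Lam_infty => /(_ (2 / del)).
move: pCn; apply: filterS3 => m pCn Lam_ge ratio_le.
rewrite minimax_prob_le1 andbT.
have := minimax_prob_lower_bound (X_iid m) (z_normal m) (Xz_indep m) hsigma (hn m) (hk m) (hp m)
  del_int delM Lam_ge del_eps.
apply: le_trans; rewrite lee_fin lerD2l lerN2 lerD2r ler_pM2l// ler_expR.
have kLam := mul_ln_ratio_le (hk m) (hp m) a0 ratio_le.
have : 2 * (2 * a * (p m)%:R) <= c * (n m)%:R.
  have -> : 2 * (2 * a * (p m)%:R) = c * ((p m)%:R / C) by rewrite /a; field; rewrite gt_eqF.
  by rewrite ler_pM2l// ler_pdivrMr// mulrC.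
have : c / C * (p m)%:R <= c * (n m)%:R.
  by rewrite mulrAC -mulrA ler_pM2l// ler_pdivrMr// mulrC.
have -> : (n m)%:R * (del / 2) ^+ 2 / 4 = 2 * (c * (n m)%:R) by rewrite /c; field.
lra.
Qed.
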